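(* Let $\mathcal{H}\in\{\{K_{1,3},Z_4\},\{K_{1,3},B_{1,2}\},\{K_{1,3},N_{1,1,1}\}\}$. Then every longest cycle of a $2$-connected $\mathcal{H}$-free graph is a dominating cycle of that graph.
   Context: All graphs are finite and simple. A cycle $C$ in a graph $G$ is dominating if every edge of $G$ has at least one end vertex on $C$. $G$ is $\mathcal{H}$-free if it contains no member of $\mathcal{H}$ as an induced subgraph. $K_{1,3}$ is the claw. $Z_4$ is obtained from a triangle by attaching a path with $4$ new vertices at one triangle vertex. $B_{1,2}$ is obtained from a triangle $abc$ by attaching a pendant vertex at $a$ and a path of $2$ new vertices at $b$. $N_{1,1,1}$ is obtained from a triangle by attaching one pendant vertex at each of its three vertices. *)

(* Defs.v *)
(* MathComp. *)
From Stdlib Require List.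
From mathcomp Require Import all_boot.
Set Implicit Arguments.
Unset Strict Implicit.
Unset Printing Implicit Defensive.

Record sgraph := SGraph {
  vertex :> finType;
  adj : rel vertex;
  adj_sym : symmetric adj;
  adj_irrefl : irreflexive adj }.

Definition connected_minus (G : sgraph) (X : {set G}) : Prop :=
  forall x y : G, x \notin X -> y \notin X ->
    connect [rel u v | [&& adj u v, u \notin X & v \notin X]] x y.

Definition k_connected (k : nat) (G : sgraph) : Prop :=
  k < #|G| /\ forall X : {set G}, #|X| < k -> connected_minus X.

Definition induced_in (H G : sgraph) : Prop :=
  exists f : H -> G, injective f /\ forall u v : H, adj (f u) (f v) = adj u v.

Definition free (Hs : seq sgraph) (G : sgraph) : Prop :=
  forall H : sgraph, List.In H Hs -> ~ induced_in H G.

(* A cycle is the cyclic list of its vertices. The bound on the size excludes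
   the lists [::] and [:: x; y] (with x, y adjacent), which satisfy ucycle;
   the length of the cycle is the size of the list. *)
Definition is_cycle (G : sgraph) (c : seq G) : Prop :=
  2 < size c /\ ucycle (@adj G) c.

Definition longest_cycle (G : sgraph) (c : seq G) : Prop :=
  is_cycle c /\ forall c' : seq G, is_cycle c' -> size c' <= size c.

Definition dominating_cycle (G : sgraph) (c : seq G) : Prop :=
  is_cycle c /\ forall x y : G, adj x y -> x \in c \/ y \in c.

Section EdgeList.
Variables (n : nat) (E : seq (nat * nat)).

Definition edge_rel : rel 'I_n := fun i j =>
  (i != j) && (((val i, val j) \in E) || ((val j, val i) \in E)).

Lemma edge_rel_sym : symmetric edge_rel.
Proof. by move=> i j; rewrite /edge_rel eq_sym orbC. Qed.

Lemma edge_rel_irrefl : irreflexive edge_rel.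
Proof. by move=> i; rewrite /edge_rel eqxx. Qed.

Definition edge_graph : sgraph := SGraph edge_rel_sym edge_rel_irrefl.
End EdgeList.

Definition K13 : sgraph := edge_graph 4 [:: (0, 1); (0, 2); (0, 3)].

(* In the next three graphs the triangle is 0, 1, 2. *)
Definition Z4 : sgraph :=
  edge_graph 7 [:: (0, 1); (1, 2); (0, 2); (0, 3); (3, 4); (4, 5); (5, 6)].

Definition B12 : sgraph :=
  edge_graph 6 [:: (0, 1); (1, 2); (0, 2); (0, 3); (1, 4); (4, 5)].

Definition N111 : sgraph :=
  edge_graph 6 [:: (0, 1); (1, 2); (0, 2); (0, 3); (1, 4); (2, 5)].

(* Main.v *)
Require Import Defs.
From Stdlib Require List.
From mathcomp Require Import all_boot.

Set Implicit Arguments.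
Unset Strict Implicit.
Unset Printing Implicit Defensive.

(* Suppose that an edge lies off the longest cycle [c], let [H] be its component
   in [G - c], and call a vertex of [c] attached if it has a neighbour in [H].
   Fix an attached [u] and sort the non-attached vertices of [c] into layers by
   their distance from [u]. By claw-freeness and maximality of [c] the first layer
   is a clique. If the layers up to the n-th one are cliques, then no other
   attached vertex has a neighbour in them ([no_att_near_clique_layers]), since
   otherwise [c] could be rerouted through [H]. But walking along [c] from [u] to
   the next attached vertex shows that some layer does have such a neighbour.

   Without an induced [N111] or [B12], all layers are cliques. Without an induced
   [Z4], if [u] has two neighbours in [H], these form with [u] a triangle that
   bounds the depth of the layers to 3, and the layers of another attached vertex
   turn out to be cliques. If every attached vertex has only one neighbour in [H],
   then the layers are again cliques, except in one configuration in which [c] has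
   at most 8 vertices and can be lengthened explicitly. *)

(** * Induced copies of the forbidden graphs *)

Section EdgeGraph.
Variables (n : nat) (E : seq (nat * nat)).

Definition nat_edge (i j : nat) : bool :=
  (i != j) && (((i, j) \in E) || ((j, i) \in E)).

Lemma induced_edge_graph (G : sgraph) (f : nat -> G) :
  (forall i j, i < j -> j < n -> adj (f i) (f j) = nat_edge i j) ->
  (forall i j, i < j -> j < n -> f i != f j) ->
  induced_in (edge_graph n E) G.
Proof.
move=> adjf neqf; exists (fun i : 'I_n => f i); split.
  move=> i j /eqP; case: (ltngtP i j) => [ltij|ltji|/val_inj//] /eqP eqf.
    by have:= neqf _ _ ltij (ltn_ord j); rewrite eqf eqxx.
  by have:= neqf _ _ ltji (ltn_ord i); rewrite eqf eqxx.
move=> i j; rewrite -[RHS]/(nat_edge i j); case: (ltngtP i j) => [ltij|ltji|/val_inj->].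
- by rewrite adjf.
- by rewrite adj_sym adjf // /nat_edge eq_sym orbC.
- by rewrite adj_irrefl /nat_edge eqxx.
Qed.

(** The known notion for a graph: distinct vertices have distinct neighbourhoods. It holds for [Z4],
    [B12] and [N111], but not for the claw, whose leaves are twins. *)
Definition point_determining : bool :=
  all (fun i => all (fun j => (j <= i) ||
    has (fun k => nat_edge i k != nat_edge j k) (iota 0 n)) (iota 0 n)) (iota 0 n).

(** Two indices with equal images would have the same neighbours in the pattern, so injectivity of
    [f] comes for free. *)
Lemma induced_point_determining (G : sgraph) (f : nat -> G) :
  point_determining ->
  (forall i j, i < j -> j < n -> adj (f i) (f j) = nat_edge i j) ->
  induced_in (edge_graph n E) G.
Proof.
move=> pdE adjf; apply: (@induced_edge_graph G f) => // i j ltij ltjn.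
have adjf' k l : k < n -> l < n -> adj (f k) (f l) = nat_edge k l.
  case: (ltngtP k l) => [ltkl|ltlk|->] ltk ltl.
  - exact: adjf.
  - by rewrite adj_sym adjf // /nat_edge eq_sym orbC.
  - by rewrite adj_irrefl /nat_edge eqxx.
have ltin := ltn_trans ltij ltjn.
have /allP/(_ i) := pdE; rewrite mem_iota => /(_ ltin)/allP/(_ j).
rewrite mem_iota => /(_ ltjn); rewrite leqNgt ltij => /hasP[k].
rewrite mem_iota => /= ltk; apply: contraNneq => eqf.
by rewrite -!adjf' // eqf.
Qed.

End EdgeGraph.

Lemma K13_induced (G : sgraph) (x a b d : G) :
  adj x a -> adj x b -> adj x d -> a != b -> a != d -> b != d ->
  ~~ adj a b -> ~~ adj a d -> ~~ adj b d -> induced_in K13 G.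
Proof.
move=> xa xb xd ab ad bd nab nad nbd.
have nx y : adj x y -> x != y by apply: contraTneq => ->; rewrite adj_irrefl.
apply: (@induced_edge_graph _ _ _ (nth x [:: x; a; b; d])).
  by case=> [|[|[|[|i]]]] [|[|[|[|j]]]] //= _ _; first [exact/idP | exact/negbTE].
by case=> [|[|[|[|i]]]] [|[|[|[|j]]]] //= _ _; apply: nx.
Qed.

Lemma Z4_induced (G : sgraph) (a b d p q r s : G) :
  adj a b -> adj a d -> adj b d -> adj a p -> adj p q -> adj q r -> adj r s ->
  ~~ adj a q -> ~~ adj a r -> ~~ adj a s ->
  ~~ adj b p -> ~~ adj b q -> ~~ adj b r -> ~~ adj b s ->
  ~~ adj d p -> ~~ adj d q -> ~~ adj d r -> ~~ adj d s ->
  ~~ adj p r -> ~~ adj p s -> ~~ adj q s -> induced_in Z4 G.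
Proof.
move=> *.
apply: (@induced_point_determining _ _ _ (nth a [:: a; b; d; p; q; r; s])) => //.
by case=> [|[|[|[|[|[|[|i]]]]]]] [|[|[|[|[|[|[|j]]]]]]] //= _ _;
  first [exact/idP | exact/negbTE].
Qed.

Lemma B12_induced (G : sgraph) (a b d p q r : G) :
  adj a b -> adj b d -> adj a d -> adj a p -> adj b q -> adj q r ->
  ~~ adj a q -> ~~ adj a r -> ~~ adj b p -> ~~ adj b r ->
  ~~ adj d p -> ~~ adj d q -> ~~ adj d r -> ~~ adj p q -> ~~ adj p r ->
  induced_in B12 G.
Proof.
move=> *.
apply: (@induced_point_determining _ _ _ (nth a [:: a; b; d; p; q; r])) => //.
by case=> [|[|[|[|[|[|i]]]]]] [|[|[|[|[|[|j]]]]]] //= _ _;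
  first [exact/idP | exact/negbTE].
Qed.

Lemma N111_induced (G : sgraph) (a b d p q r : G) :
  adj a b -> adj b d -> adj a d -> adj a p -> adj b q -> adj d r ->
  ~~ adj a q -> ~~ adj a r -> ~~ adj b p -> ~~ adj b r ->
  ~~ adj d p -> ~~ adj d q -> ~~ adj p q -> ~~ adj p r -> ~~ adj q r ->
  induced_in N111 G.
Proof.
move=> *.
apply: (@induced_point_determining _ _ _ (nth a [:: a; b; d; p; q; r])) => //.
by case=> [|[|[|[|[|[|i]]]]]] [|[|[|[|[|[|j]]]]]] //= _ _;
  first [exact/idP | exact/negbTE].
Qed.

(** * Distance layers around a root vertex *)

Section Layers.
Variables (T : finType) (e : rel T) (Y : {set T}) (u : T).

(** Distances are those of the graph induced on [Y] and the root. The root may lie outside [Y]: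
    below it is mostly an attached vertex, with [inner] as [Y]. *)
Fixpoint ball_def (n : nat) : {set T} :=
  if n is m.+1 then ball_def m :|: [set y in Y | [exists x in ball_def m, e x y]]
  else [set u].

(* The layers are locked because otherwise the conversion test tries to unfold
   the finite sets when comparing two distinct layers. *)
Fact layers_key : unit. Proof. by []. Qed.
Definition ball : nat -> {set T} := locked_with layers_key ball_def.
Definition lay : nat -> {set T} := locked_with layers_key
  (fun n => if n is m.+1 then ball n :\: ball m else [set u]).

Lemma ball0 x : (x \in ball 0) = (x == u).
Proof. by rewrite /ball locked_withE in_set1. Qed.

Lemma in_ballS n y :
  (y \in ball n.+1) = (y \in ball n) || (y \in Y) && [exists x in ball n, e x y].
Proof. by rewrite /ball locked_withE /= in_setU inE. Qed.

Lemma lay_root : u \in lay 0.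
Proof. by rewrite /lay locked_withE set11. Qed.

Lemma lay0 x : x \in lay 0 -> x = u.
Proof. by rewrite /lay locked_withE => /set1P. Qed.

Lemma in_layS n x : (x \in lay n.+1) = (x \notin ball n) && (x \in ball n.+1).
Proof. by rewrite /lay locked_withE in_setD. Qed.

Lemma sub_ball m n : m <= n -> ball m \subset ball n.
Proof.
move=> /subnKC <-; elim: (n - m) => [|k IHk]; first by rewrite addn0.
apply: subset_trans IHk _; apply/subsetP=> x xb.
by rewrite addnS in_ballS xb.
Qed.

Lemma ballS n x y : x \in ball n -> y \in Y -> e x y -> y \in ball n.+1.
Proof.
by move=> xn yY xy; rewrite in_ballS yY; apply/orP; right; apply/exists_inP; exists x.
Qed.

Lemma lay_ball i n x : i <= n -> x \in lay i -> x \in ball n.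
Proof.
move=> lein xi; apply: (subsetP (sub_ball lein)).
case: i xi {lein} => [/lay0->|i]; first by rewrite ball0.
by rewrite in_layS => /andP[].
Qed.

Lemma ball_lay n x : x \in ball n -> exists2 i, i <= n & x \in lay i.
Proof.
elim: n => [|n IHn]; first by rewrite ball0 => /eqP->; exists 0; rewrite ?lay_root.
move=> xn.
case: (boolP (x \in ball n)) => [/IHn[i lein xi]|xNn].
  by exists i => //; apply: leqW.
by exists n.+1 => //; rewrite in_layS xNn.
Qed.

Lemma lay_notin_ball i n x : n < i -> x \in lay i -> x \notin ball n.
Proof.
case: i => [|i] // ltni; rewrite in_layS => /andP[xNi _].
by apply: contra xNi; apply/subsetP/sub_ball.
Qed.

Lemma lay_inj i j x : x \in lay i -> x \in lay j -> i = j.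
Proof.
move=> xi xj; case: (ltngtP i j) => // [ltij|ltji].
  by have:= lay_notin_ball ltij xj; rewrite (lay_ball _ xi).
by have:= lay_notin_ball ltji xi; rewrite (lay_ball _ xj).
Qed.

Lemma lay_neq i j x y : i != j -> x \in lay i -> y \in lay j -> x != y.
Proof. by move=> /eqP ij xi; apply: contraTneq => <-; apply/negP=> /(lay_inj xi). Qed.

Lemma lay_pred n y : y \in lay n.+1 -> exists2 x, x \in lay n & e x y.
Proof.
rewrite in_layS in_ballS => /andP[/[dup] yNn /negPf->].
case/andP=> yY /exists_inP[x xn xy]; exists x => //.
have [i lein xi] := ball_lay xn; move: lein; rewrite leq_eqVlt.
case/predU1P=> [<- //|ltin]; case/negP: yNn.
by apply: (subsetP (sub_ball ltin)); apply: (ballS (lay_ball (leqnn i) xi)).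
Qed.

Lemma layS_sub n y : y \in lay n.+1 -> y \in Y.
Proof.
by rewrite in_layS in_ballS => /andP[/negPf-> /andP[]].
Qed.

Lemma lay_step i x y : x \in lay i -> y \in Y -> e x y ->
  exists2 j, j <= i.+1 & y \in lay j.
Proof. by move=> xi yY xy; apply: ball_lay; apply: ballS xy => //; apply: lay_ball xi. Qed.

Lemma lay_far i j x y : i.+1 < j -> x \in lay i -> y \in lay j -> ~~ e x y.
Proof.
case: j => // j ltij xi yj; apply/negP=> xy.
have [k lek yk] := lay_step xi (layS_sub yj) xy.
by move: ltij; rewrite -(lay_inj yk yj) ltnNge lek.
Qed.

Lemma ball_layS n x : (x \in ball n.+1) = (x \in ball n) || (x \in lay n.+1).
Proof. by rewrite in_layS in_ballS; case: (x \in ball n). Qed.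

Lemma lay1E y : u \notin Y -> (y \in lay 1) = (y \in Y) && e u y.
Proof.
move=> uY; rewrite in_layS in_ballS !ball0; apply/idP/idP.
  by case/andP=> /negPf-> /andP[-> /exists_inP[x]]; rewrite ball0 => /eqP->.
case/andP=> yY uy; rewrite yY; apply/andP; split.
  by apply: contraNneq uY => <-.
by apply/orP; right; apply/exists_inP; exists u; rewrite ?ball0.
Qed.

End Layers.

(** * Deletion of vertices from a path, and crossing edges *)

Section Paths.
Variables (T : eqType) (e : rel T).

(** Here [x] is the last vertex kept and [z] the last one read: they agree, or [z] lies in a deleted
    run that was entered from [x]. When the run ends, [skip] joins its two outer neighbours, which
    differ because the path has no repetition. *)
Lemma path_filter (e1 : rel T) (B : pred T) :
  (forall f b b' f', ~~ B f -> ~~ B f' -> B b -> B b' -> e f b -> e b' f' ->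
     f != f' -> e1 f f') -> subrel e e1 ->
  forall p x z, z = x \/ (B z /\ exists2 b, B b & e x b) -> ~~ B x ->
  path e z p -> uniq (x :: p) -> path e1 x [seq y <- p | ~~ B y].
Proof.
move=> skip sub; elim=> //= y p IHp x z zx Bx /andP[zy yp].
rewrite inE negb_or => /andP[/andP[xy xp] /andP[yNp up]].
case: (boolP (B y)) => /= By.
  apply: (IHp x y) => //; last by rewrite /= xp.
  by right; split=> //; case: zx => [zx|[_ //]]; exists y => //; rewrite -zx.
apply/andP; split; last by apply: (IHp y y) => //=; [left | rewrite yNp].
by case: zx => [<-|[Bz [b Bb xb]]]; [apply: sub | apply: skip xb zy xy].
Qed.

Lemma path_crossing (P : pred T) x p : path e x p -> P x -> ~~ P (last x p) ->
  exists a b, [/\ a \in x :: p, b \in x :: p, e a b, P a & ~~ P b].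
Proof.
elim: p x => [|y p IHp] x /=; first by move=> _ ->.
case/andP=> xy yp Px Pl; have [Py|Py] := boolP (P y); last first.
  by exists x, y; rewrite !inE !eqxx orbT.
have [a [b [ap bp ab Pa Pb]]] := IHp y yp Py Pl.
by exists a, b; rewrite inE ap orbT inE bp orbT.
Qed.

End Paths.

Ltac solve_adj := first [done | by rewrite adj_sym].

(** * A longest cycle and a component off it *)

Section LongestCycle.
Variables (G : sgraph) (c : seq G) (H : {set G}).
Hypothesis claw_free : ~ induced_in K13 G.
Hypothesis c_longest : longest_cycle c.
(** The three hypotheses on [H] say that it is empty or a component of [G - c]. *)
Hypothesis H_off_c : forall x, x \in H -> x \notin c.
Hypothesis H_closed : forall x y, x \in H -> adj x y -> y \notin c -> y \in H.
Hypothesis H_connected : forall x y, x \in H -> y \in H ->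
  exists p, [/\ path (@adj G) x p, last x p = y, uniq (x :: p) & {subset x :: p <= H}].

Lemma claw (x a b d : G) : adj x a -> adj x b -> adj x d ->
  a != b -> a != d -> b != d -> ~~ adj a b -> ~~ adj a d -> adj b d.
Proof.
move=> xa xb xd ab ad bd nab nad; apply/negPn/negP=> nbd.
by apply: claw_free; apply: (@K13_induced _ x a b d).
Qed.

Lemma adj_neq (x y : G) : adj x y -> x != y.
Proof. by apply: contraTneq => ->; rewrite adj_irrefl. Qed.

Definition att (x : G) := (x \in c) && [exists y in H, adj x y].
Definition inner : {set G} := [set x in c | ~~ att x].

Definition clique (S : {set G}) := {in S &, forall x y, x != y -> adj x y}.

Lemma attP (u : G) : reflect (u \in c /\ exists2 x : G, x \in H & adj u x) (att u).
Proof.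
apply: (iffP andP) => -[uc uH]; split=> //; last exact/exists_inP.
by case/exists_inP: uH => x; exists x.
Qed.

Lemma att_adj u : att u -> exists2 x : G, x \in H & adj u x.
Proof. by case/attP. Qed.

Lemma H_att x y : x \in H -> adj x y -> y \notin H -> att y.
Proof.
move=> xH xy yNH; apply/attP; split; last by exists x; rewrite // adj_sym.
by apply: contraR yNH; apply: H_closed xy.
Qed.

Lemma inner_H x y : x \in inner -> y \in H -> ~~ adj x y.
Proof.
by rewrite inE => /andP[xc nA] yH; apply: contra nA => xy; apply/attP; split=> //; exists y.
Qed.

Lemma inner_neqH x y : x \in inner -> y \in H -> y != x.
Proof.
by rewrite inE => /andP[xc _] /H_off_c; apply: contraNneq => ->.
Qed.

Lemma att_inner x y : att x -> y \in inner -> x != y.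
Proof. by move=> xA; rewrite inE => /andP[_]; apply: contraNneq => <-. Qed.

Lemma attNinner x : att x -> x \notin inner.
Proof. by move=> xA; rewrite inE xA andbF. Qed.

Lemma att_neqH u x : att u -> x \in H -> x != u.
Proof. by case/attP=> uc _ /H_off_c; apply: contraNneq => ->. Qed.

(** The two paths, one outside [H] and one inside, close up to a cycle, which cannot beat [c]. *)
Lemma path_through_H u v x y p h : x \in H -> y \in H -> adj u x -> adj v y ->
  path (@adj G) x h -> last x h = y -> uniq (x :: h) -> {subset x :: h <= H} ->
  path (@adj G) v p -> last v p = u -> uniq (v :: p) -> {subset v :: p <= [predC H]} ->
  u != v -> size (v :: p) + size (x :: h) <= size c.
Proof.
move=> xH yH ux vy xh hy uh hH vp pu up pH uv.
have [_ c_max] := c_longest.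
rewrite -size_cat; apply: c_max; split.
  rewrite size_cat /=; case: p pu {up pH vp} uv => [/= ->|z p _ _]; first by rewrite eqxx.
  by rewrite /= !addSn addnS.
apply/andP; split.
  by rewrite /= rcons_cat cat_path vp pu /= ux rcons_path xh hy adj_sym vy.
rewrite cat_uniq up uh andbT; apply/hasPn=> z zh; apply/negP=> /pH.
by rewrite inE /=; case/negP; apply: hH.
Qed.

(** Closing such a path through [H] adds at least one vertex, which contradicts the maximality of
    [c]. *)
Lemma ham_path_attached u v p : att u -> att v -> u != v ->
  path (@adj G) v p -> last v p = u -> uniq (v :: p) -> {subset v :: p <= [predC H]} ->
  size c <= size (v :: p) -> False.
Proof.
move=> /att_adj[x xH ux] /att_adj[y yH vy] uv vp pu up pH.
have [h [xh hy uh hH]] := H_connected xH yH.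
have := path_through_H xH yH ux vy xh hy uh hH vp pu up pH uv.
by move=> le1 le2; have := leq_trans le1 le2; rewrite -[leqRHS]addn0 leq_add2l.
Qed.

(** Trades the cyclic order for a list that starts at [x]. The clause on an arbitrary [e] is there
    because consecutive vertices of [c] satisfy finer relations than adjacency, which have to
    survive the opening. *)
Lemma open_cycle_at x : x \in c -> exists q, [/\ path (@adj G) x q, adj (last x q) x,
  uniq (x :: q), perm_eq (x :: q) c &
    [/\ next c x = head x q, prev c x = last x q &
        forall e, cycle e c -> path e x q]].
Proof.
case: c_longest => -[_ /andP[cc uc]] _ xc.
have [i q defq] := rot_to xc; exists q.
have xq : cycle (@adj G) (x :: q) by rewrite -defq path.rot_cycle.
have uq : uniq (x :: q) by rewrite -defq rot_uniq.
move: xq; rewrite /= rcons_path => /andP[-> ->]; split=> //.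
  by rewrite -defq perm_rot.
rewrite -(next_rot i uc) -(prev_rot i uc) defq; split; last 1 first.
  by move=> e; rewrite -(path.rot_cycle i) defq /= rcons_path => /andP[].
  by case: q {defq uq} => [|y q] /=; rewrite eqxx.
have prev_last z : x \notin q -> prev_at x x z q = last z q.
  elim: q z {defq uq} => [|y q IHq] z /=; first by rewrite eqxx.
  by rewrite inE negb_or => /andP[/negPf-> /IHq].
move: uq => /= /andP[xq _]; rewrite -(prev_last x xq).
by case: q {defq xq prev_last} => [|y q] //=; rewrite eqxx.
Qed.

Lemma c_notin_H x : x \in c -> x \notin H.
Proof. by apply: contraL; apply: H_off_c. Qed.

Lemma inner_c x : x \in inner -> x \in c.
Proof. by rewrite inE => /andP[]. Qed.

Lemma next_c_adj x : x \in c ->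
  [/\ adj x (next c x), adj x (prev c x) & next c x != prev c x].
Proof.
move=> xc; have [q [xq qx uq pq [-> -> _]]] := open_cycle_at xc.
have: 2 < size (x :: q) by rewrite (perm_size pq); case: c_longest => -[].
case: q xq qx uq pq => [|y [|z q]] //= /andP[xy _] qx uq _ _.
split=> //; first by rewrite adj_sym.
by move: uq => /and3P[_ yzq _]; apply: contraNneq yzq => ->; apply: mem_last.
Qed.

Lemma att_c x : att x -> x \in c.
Proof. by case/andP. Qed.

(** Otherwise [c] without the edge from [x] to its successor is a path through all of [c] between
    two attached vertices. *)
Lemma next_attN x : att x -> ~~ att (next c x).
Proof.
move=> xA; apply/negP; have xc := att_c xA.
have [xn _ _] := next_c_adj xc; have := adj_neq xn.
have [q [xq qx uq pq [-> _ _]]] := open_cycle_at xc.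
case: q xq qx uq pq => [|y q] /=; first by rewrite eqxx.
move=> /andP[xy yq] qx uq pq neq yA.
apply: (@ham_path_attached x y (rcons q x)) => //; rewrite ?last_rcons //.
- by rewrite rcons_path yq.
- by rewrite -rcons_cons rcons_uniq; apply: uq.
- move=> z; rewrite -rcons_cons mem_rcons (perm_mem pq); apply: c_notin_H.
- by rewrite /= size_rcons -(perm_size pq).
Qed.

Lemma next_inner u : att u -> next c u \in inner.
Proof. by move=> uA; rewrite inE mem_next (att_c uA) next_attN. Qed.

Lemma prev_inner u : att u -> prev c u \in inner.
Proof.
move=> uA; rewrite inE mem_prev (att_c uA) /=; apply/negP=> /next_attN.
by case: c_longest => -[_ /andP[_ uc]] _; rewrite next_prev // uA.
Qed.

(** A neighbour of [u] in [H] misses both [t] and [t'], so only the edge between them prevents a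
    claw at [u]. *)
Lemma att_nbr_clique u t t' : att u -> t \in inner -> t' \in inner ->
  adj u t -> adj u t' -> t != t' -> adj t t'.
Proof.
move=> /att_adj[x xH ux] tY t'Y ut ut' neq.
by apply: (claw ux ut ut') => //; rewrite ?(inner_neqH _ xH) // adj_sym inner_H.
Qed.

(** The same claw with the roles exchanged: [next c u] misses [H]. *)
Lemma att_nbr_H_clique u x y : att u -> x \in H -> y \in H ->
  adj u x -> adj u y -> x != y -> adj x y.
Proof.
move=> uA xH yH ux uy neq; have nY := next_inner uA.
have [un _ _] := next_c_adj (att_c uA).
by apply: (claw un ux uy) => //; rewrite ?inner_H // eq_sym inner_neqH.
Qed.

Lemma rev_path_adj (x : G) p : path (@adj G) (last x p) (rev (belast x p)) = path (@adj G) x p.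
Proof. by rewrite rev_path; apply: eq_path => y z; apply: adj_sym. Qed.

(* The cycle [v :: q] can be reopened so as to end at the neighbour [t] of [v]:
   either [t] can be skipped, or the claw at [t] gives a chord from [v]. *)
Lemma reopen_cycle (v t a b : G) q : path (@adj G) v q -> uniq (v :: q) ->
  head v q = a -> last v q = b -> adj v t -> adj v b -> adj a b -> t \in q ->
  t = a \/ adj t a -> t = b \/ adj t b ->
  exists p, [/\ path (@adj G) v p, perm_eq p q & last v p = t].
Proof.
move=> vq uq qa qb vt vb ab tq ta tb.
have [eta|nta] := eqVneq t a.
  case: q qa qb vq tq {uq} => [|a' q] //= -> qb /andP[va aq] _.
  exists (rev (a :: q)); split; last by rewrite rev_cons last_rcons.
    by rewrite lastI rev_rcons /= rev_path_adj aq qb vb.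
  by rewrite perm_rev.
have [etb|ntb] := eqVneq t b; first by exists q; rewrite etb.
case: ta => [/eqP|ta]; first by rewrite (negPf nta).
case: tb => [/eqP|tb]; first by rewrite (negPf ntb).
case/splitPr: q / tq vq uq qa qb => -[|a' q1] [|t2 q2];
  rewrite ?cats1 ?last_rcons ?last_cat //=.
- by move=> _ _ eta; rewrite eta eqxx in nta.
- by move=> _ _ eta; rewrite eta eqxx in nta.
- by move=> _ _ _ etb; rewrite etb eqxx in ntb.
rewrite cat_path /= => /and5P[va aq1 q1t tt2 t2q2] uq ea eb; subst a'.
set t1 := last a q1 in q1t.
have aq1_rev : path (@adj G) t1 (rev (belast a q1)) by rewrite rev_path_adj.
have t2q2_rev : path (@adj G) b (rev (belast t2 q2)) by rewrite -eb rev_path_adj.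
have t1a : last t1 (rev (belast a q1)) = a.
  have: last t1 (rev (a :: q1)) = a by rewrite rev_cons last_rcons.
  by rewrite lastI rev_rcons.
have t2b : last b (rev (belast t2 q2)) = t2.
  have: last b (rev (t2 :: q2)) = t2 by rewrite rev_cons last_rcons.
  by rewrite lastI rev_rcons /= eb.
have [t1v|t1v] := boolP (adj t1 v).
  exists (rev (a :: q1) ++ rcons (rev (t2 :: q2)) t); split; last by rewrite last_cat last_rcons.
    rewrite !lastI !rev_rcons eb /= cat_path /= adj_sym t1v aq1_rev t1a ab.
    by rewrite rcons_path t2q2_rev t2b adj_sym.
  rewrite -(cat_cons a); apply: perm_cat; first by rewrite perm_rev.
  by rewrite perm_rcons perm_cons perm_rev.
have [t2v|t2v] := boolP (adj t2 v).
  exists ((t2 :: q2) ++ rcons (a :: q1) t); split; last by rewrite last_cat last_rcons.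
    by rewrite cat_path /= adj_sym t2v t2q2 eb adj_sym ab rcons_path aq1 q1t.
  by rewrite perm_catC cat_rcons.
exists ((a :: q1) ++ rcons (t2 :: q2) t); split; last by rewrite last_cat last_rcons.
  have [t1c t2c vc] : [/\ t1 != t2, t1 != v & t2 != v].
    have t1q : t1 \in a :: q1 by apply: mem_last.
    have: uniq ((v :: a :: q1) ++ [:: t, t2 & q2]) by apply: uq.
    rewrite cat_uniq => /and3P[/andP[vq1 _] /hasPn dis _].
    have := dis t2; rewrite !inE eqxx orbT => /(_ isT); rewrite negb_or => /andP[-> t2q1].
    by split=> //; [apply: contraNneq t2q1 => <- | apply: contraNneq vq1 => <-].
  have t12 : adj t1 t2.
    by apply: (@claw t v); rewrite // 1?(adj_sym t) // 1?eq_sym // adj_sym.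
  by rewrite cat_path /= va aq1 rcons_path -/t1 t12 t2q2 eb adj_sym tb.
by rewrite -(cat_cons a) perm_cat2l perm_rcons.
Qed.

(** * The layers of an attached vertex *)

Section Root.
Variable u : G.
Hypothesis u_att : att u.

Notation L := (lay (@adj G) inner u).
Notation B := (ball (@adj G) inner u).

Lemma lay1P t : (t \in L 1) = (t \in inner) && adj u t.
Proof. by rewrite lay1E // attNinner. Qed.

Lemma layS_inner i x : x \in L i.+1 -> x \in inner.
Proof. exact: layS_sub. Qed.

Lemma lay_c i x : x \in L i -> x \in c.
Proof.
by case: i => [/lay0->|i /layS_inner/inner_c//]; apply: att_c.
Qed.

Lemma clique_lay0 : clique (L 0).
Proof. by move=> x y /lay0-> /lay0->; rewrite eqxx. Qed.

Lemma clique_lay1 : clique (L 1).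
Proof.
move=> x y; rewrite !lay1P => /andP[xY ux] /andP[yY uy].
exact: att_nbr_clique uy.
Qed.

(** The ball is swept layer by layer: inside a clique the vertices can be visited in any order. *)
Lemma ham_path_ball n s : (forall i, i <= n -> clique (L i)) -> s \in L n ->
  exists r, [/\ path (@adj G) u r, uniq (u :: r), u :: r =i B n & last u r = s].
Proof.
elim: n s => [|n IHn] s cl sn.
  exists [::]; split=> //; last by rewrite (lay0 sn).
  by move=> x; rewrite inE ball0.
(* The last layer is entered at [d] and left at [s]; the two coincide only if this layer is a
   singleton. *)
have [d dn [rest [uR sR mR]]] : exists2 d, d \in L n.+1 &
    exists rest, [/\ uniq (d :: rest), last d rest = s & d :: rest =i L n.+1].
  case: (pickP [pred d in L n.+1 | d != s]) => [d /andP[/= dn ds]|only].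
    exists d => //; exists (rcons (enum (L n.+1 :\ d :\ s)) s); split.
    - rewrite rcons_uniq mem_rcons inE !mem_enum !in_setD1 enum_uniq.
      by rewrite negb_or (negPf ds) !eqxx !andbF.
    - by rewrite last_rcons.
    - move=> x; rewrite inE mem_rcons inE mem_enum !in_setD1.
      have [->|_] := eqVneq x d; first by rewrite dn.
      by have [->|_] := eqVneq x s; first by rewrite sn.
  exists s => //; exists [::]; split=> // x; rewrite inE.
  have := only x; rewrite /=; have [->|_] := eqVneq x s; first by rewrite sn.
  by rewrite andbT => ->.
have [s' s'n s'd] := lay_pred dn.
have [r [ur uqr mr rs]] := IHn s' (fun i lei => cl i (leqW lei)) s'n.
exists (r ++ d :: rest); split; last by rewrite last_cat.
- rewrite cat_path ur rs /= s'd /=.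
  have: {subset d :: rest <= L n.+1} by move=> x; rewrite mR.
  elim: rest d uR {sR mR s'd dn} => //= y rest IHr d /andP[dy uy] sub.
  rewrite IHr ?andbT //; last by move=> x xr; apply: sub; rewrite inE xr orbT.
  apply: (cl n.+1) => //; rewrite ?sub ?inE ?eqxx ?orbT //.
  by apply: contraNneq dy => ->; rewrite inE eqxx.
- rewrite -cat_cons cat_uniq uqr uR andbT; apply/hasPn=> x; rewrite mR => xn.
  by rewrite /= mr; apply: lay_notin_ball xn.
- by move=> x; rewrite -cat_cons mem_cat mr mR ball_layS.
Qed.

Lemma layers_reach_att v : att v -> v != u ->
  exists i a t, [/\ att a, a != u, t \in L i.+1 & adj a t].
Proof.
move=> vA vu; have uc := att_c u_att.
have [q [uq _ /= /andP[uNq _] pq [nq _ _]]] := open_cycle_at uc.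
have vq : v \in q by have := att_c vA; rewrite -(perm_mem pq) inE (negPf vu).
have qc x : x \in q -> x \in c by rewrite -(perm_mem pq) inE orbC => ->.
have {nq} uqN : ~~ att (head u q) by rewrite -nq next_attN.
case: q uq uNq vq qc uqN {pq} => [|y q] //= /andP[uy yq] uNq vq qc yNA.
have y1 : y \in L 1 by rewrite lay1P inE qc ?mem_head // yNA.
have {vq} vq : v \in q.
  by move: vq; rewrite inE => /predU1P[vy|//]; rewrite -vy vA in yNA.
have {uNq} uNq : u \notin q by move: uNq; rewrite inE negb_or => /andP[].
have {qc} qc x : x \in q -> x \in c by move=> xq; apply: qc; rewrite inE xq orbT.
(* Invariant: the current vertex [y] lies in layer [i.+1]. Its successor [z] is not [u], so it is
   attached or lies again in a layer of positive index; the walk stops at [v] at the latest. *)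
elim: q y 0 {uy yNA} yq y1 uNq vq qc => //= z q IHq y i /andP[yz zq] yi uNq vq qc.
move: uNq; rewrite inE negb_or => /andP[uz uNq].
have [zA|zNA] := boolP (att z).
  by exists i, z, y; rewrite eq_sym uz adj_sym.
have zY : z \in inner by rewrite inE qc ?mem_head.
have [[|j] _ zj] := lay_step yi zY yz.
  by rewrite (lay0 zj) eqxx in uz.
apply: (IHq z j) => // [|x xq]; last by apply: qc; rewrite inE xq orbT.
by move: vq; rewrite inE => /predU1P[vz|//]; rewrite -vz vA in zNA.
Qed.

(* Take the first layer [i = n.+1] meeting the neighbourhood of some attached
   [v != u], say in [t], and let [s] in layer [n] be adjacent to [t]. As layer [i]
   is a clique, deleting the ball of radius [n] from [c] and joining the loose ends
   leaves a cycle; it reopens into a path from [v] to [t], which continues through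
   [s] over the whole ball to [u]. *)
Lemma no_att_near_clique_layers N : (forall i, i <= N -> clique (L i)) ->
  forall i, 0 < i <= N -> forall v t, att v -> v != u -> t \in L i -> ~~ adj v t.
Proof.
move=> cl; elim/ltn_ind => -[//|n] IHn /andP[_ leN] v t vA vu tn.
apply/negP=> vt; have vc := att_c vA.
have vB : v \notin B n.
  apply/negP=> /ball_lay[[|i] _]; first by move/lay0=> eqvu; rewrite eqvu eqxx in vu.
  by move/layS_inner; apply/negP/attNinner.
have nbrB w : w \in inner -> adj v w -> w \notin B n.
  move=> wY vw; apply/negP=> /ball_lay[[|i] lein wi].
    by rewrite (lay0 wi) (negPf (attNinner u_att)) in wY.
  have := IHn i.+1 lein; rewrite (leq_trans lein (ltnW leN)) => /(_ isT v w vA vu wi).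
  by rewrite vw.
have [q [vq qv uq pq [nq prq pathq]]] := open_cycle_at vc.
set q' := [seq x <- q | x \notin B n].
have [vn vp np] := next_c_adj vc.
have nY := next_inner vA; have pY := prev_inner vA.
have nB := nbrB _ nY vn; have pB := nbrB _ pY vp.
have qcm x : x \in v :: q -> x \in c by rewrite (perm_mem pq).
(* The relation remembers that consecutive vertices of [c] are not both attached. This rules out an
   attached vertex next to [u] at the end of a deleted run; next to other vertices of the ball,
   [IHn] does. *)
pose e (x y : G) := [&& x \in c, y \in c, adj x y & ~~ (att x && att y)].
have next_e x : x \in c -> e x (next c x).
  move=> xc; have [xn _ _] := next_c_adj xc.
  by rewrite /e xc mem_next xc xn /=; apply/nandP/orP; case: (boolP (att x)) => // /next_attN ->.
have vq_e : path e v q.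
  apply/pathq/cycle_from_next => //.
  by case: c_longest => -[_ /andP[]].
have vq' : path (@adj G) v q'.
  apply: (@path_filter _ e _ (mem (B n))) vq_e uq => //.
  - have lay_next f b : f \notin B n -> b \in B n -> f \in c -> adj f b ->
        ~~ (att f && att b) -> f \in L n.+1.
      move=> fB bB fc fb fbNA; suff: f \in B n.+1 by rewrite ball_layS (negPf fB).
      apply: (ballS bB); last by rewrite adj_sym.
      rewrite inE fc /=; apply/negP=> fA.
      have [[|i] lein bi] := ball_lay bB.
        by move: fbNA; rewrite fA (lay0 bi) u_att.
      have := IHn i.+1 lein; rewrite (leq_trans lein (ltnW leN)) => /(_ isT f b fA).
      rewrite fb => /(_ _ bi)H0; suff /H0 : f != u by [].
      by apply: contraNneq fB => ->; apply: (lay_ball (leq0n n)); rewrite lay_root.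
    move=> f b b' f' fB f'B bB b'B /and4P[fc _ fb fbA] /and4P[_ f'c b'f' b'f'A] neq.
    apply: (cl n.+1) => //; first exact: lay_next fb fbA.
    by apply: (lay_next f' b') => //; rewrite 1?adj_sym // andbC.
  - by move=> x y /and4P[].
  - by left.
have uq' : uniq (v :: q').
  by move: uq => /= /andP[vNq uq]; rewrite filter_uniq // mem_filter negb_and vNq orbT.
have tq' : t \in q'.
  rewrite mem_filter (lay_notin_ball (ltnSn n) tn) /=.
  have := lay_c tn; rewrite -(perm_mem pq) inE => /predU1P[etv|//].
  by rewrite etv adj_irrefl in vt.
have hq' : head v q' = next c v.
  rewrite nq; rewrite nq in nB; rewrite /q'; case: (q) nB => [|x q0] //= ->.
  by [].
have lq' : last v q' = prev c v.
  rewrite prq; rewrite prq in pB; rewrite /q'; case: (lastP q) pB => [|q0 x] //.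
  by rewrite filter_rcons !last_rcons => ->; rewrite last_rcons.
have tY := layS_inner tn.
have [p [vp' pp pt]] : exists p, [/\ path (@adj G) v p, perm_eq p q' & last v p = t].
  apply: (reopen_cycle vq' uq' hq' lq') => //.
  - exact: (att_nbr_clique vA nY pY vn vp np).
  - have [->|ne] := eqVneq t (next c v); [by left | right].
    exact: (att_nbr_clique vA tY nY vt vn ne).
  - have [->|ne] := eqVneq t (prev c v); [by left | right].
    exact: (att_nbr_clique vA tY pY vt vp ne).
have [s sn st] := lay_pred tn.
have [r [ur uqr mr rs]] := ham_path_ball (fun i lei => cl i (leq_trans lei (ltnW leN))) sn.
apply: (@ham_path_attached u v (p ++ rev (u :: r))) => //.
- by rewrite eq_sym.
- rewrite cat_path vp' pt /= lastI rev_rcons /= rs adj_sym st /=.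
  by have := rev_path_adj u r; rewrite ur rs.
- by rewrite last_cat rev_cons last_rcons.
- have pvB x : x \in v :: p -> x \notin B n.
    rewrite inE (perm_mem pp) mem_filter => /predU1P[->|/andP[]] //.
  rewrite -cat_cons cat_uniq rev_uniq uqr andbT cons_uniq (perm_mem pp) (perm_uniq pp).
  rewrite -cons_uniq uq' /=; apply/hasPn=> x; rewrite mem_rev mr.
  by apply: contraL; apply: pvB.
- move=> x; rewrite -cat_cons mem_cat mem_rev mr => xin; apply: c_notin_H.
  case/orP: xin => [|/ball_lay[i _ /lay_c//]].
  rewrite inE (perm_mem pp) mem_filter => /predU1P[->|/andP[_ xq]] //.
  by apply: qcm; rewrite inE xq orbT.
(* The vertices of [c] outside the ball are all in [v :: p], and those inside it are at most as many
   as the vertices of [u :: r]. *)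
- rewrite -cat_cons size_cat size_rev /= (perm_size pp) size_filter.
  rewrite -(perm_size pq) /= addSn ltnS -(count_predC (mem (B n)) q) addnC leq_add2l.
  rewrite -size_filter -[(size r).+1]/(size (u :: r)); apply: uniq_leq_size.
    by move: uq => /= /andP[_ uq]; apply: filter_uniq.
  by move=> x; rewrite mem_filter mr => /andP[].
Qed.

(** Layers 0 and 1 are always cliques, so the preceding lemma applies to layer 1 unconditionally. *)
Lemma inner_nbr_att v t : att v -> v != u -> t \in inner -> adj u t -> ~~ adj v t.
Proof.
move=> vA vu tY ut; apply: (@no_att_near_clique_layers 1 _ 1) => //.
  by case=> [|[|]] // _; [apply: clique_lay0 | apply: clique_lay1].
by rewrite lay1P tY.
Qed.

(** * Clique layers without an induced [N111] or [B12] *)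

Lemma below n s : s \in L n -> exists2 s', adj s s' &
  forall j y, n < j -> y \in L j -> ~~ adj s' y.
Proof.
case: n => [|n] sn.
  have [x xH ux] := att_adj u_att.
  exists x; [by rewrite (lay0 sn) | case=> // j y _ /layS_inner yY].
  by rewrite adj_sym inner_H.
have [s' s'n s's] := lay_pred sn.
by exists s' => [|j y ltj yj]; [rewrite adj_sym | exact: lay_far ltj s'n yj].
Qed.

(** A common neighbour of [d] and [d'] in layer [n.+1] would be the centre of a claw with its own
    predecessor. So [d] and [d'] have different predecessors [w] and [w'], adjacent in their clique,
    and the claw at [w] with leaves [d], [s], [w'] puts [s] below both: a triangle with two private
    neighbours. *)
Lemma layer_gap n d d' : clique (L n.+1) ->
  d \in L n.+2 -> d' \in L n.+2 -> d != d' -> ~~ adj d d' ->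
  exists w w' s, [/\ [/\ w \in L n.+1, w' \in L n.+1 & s \in L n],
    [/\ adj w s, adj w' s & adj w w'], [/\ adj w d & adj w' d'] &
    [/\ ~~ adj w d', ~~ adj w' d, ~~ adj s d & ~~ adj s d']].
Proof.
move=> cl dn d'n dd' ndd'.
have one_nbr w x y : w \in L n.+1 -> x \in L n.+2 -> y \in L n.+2 -> x != y ->
    ~~ adj x y -> adj w x -> ~~ adj w y.
  move=> wn xn yn xy nxy wx; apply/negP=> wy; have [s sn sw] := lay_pred wn.
  have sx := lay_far (ltnSn n.+1) sn xn; have sy := lay_far (ltnSn n.+1) sn yn.
  by case/negP: nxy; apply: (claw _ wx wy) sx sy; rewrite 1?adj_sym //;
    [apply: lay_neq sn xn | apply: lay_neq sn yn]; rewrite neq_ltn leqnSn.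
have [w wn wd] := lay_pred dn; have [w' w'n w'd'] := lay_pred d'n.
have wd' := one_nbr _ _ _ wn dn d'n dd' ndd' wd.
have w'd : ~~ adj w' d.
  by apply: (one_nbr _ _ _ w'n d'n dn); rewrite // 1?eq_sym // adj_sym.
have ww' : adj w w' by apply: cl => //; apply: contraNneq wd' => ->.
have [s sn sw] := lay_pred wn.
have sd := lay_far (ltnSn n.+1) sn dn; have sd' := lay_far (ltnSn n.+1) sn d'n.
exists w, w', s; split=> //; split=> //; try solve_adj.
rewrite adj_sym; apply: (@claw w d) => //; try by rewrite adj_sym.
- by apply: lay_neq dn sn; rewrite neq_ltn leqnSn orbT.
- by apply: lay_neq dn w'n; rewrite neq_ltn leqnn orbT.
- by apply: lay_neq sn w'n; rewrite neq_ltn leqnn.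
Qed.

(** The triangle from [layer_gap] has pendant vertices [d] and [d']; [below] supplies the third one,
    in the previous layer or, for [s = u], in [H]. *)
Lemma lay_clique_N111 : ~ induced_in N111 G -> forall n, clique (L n).
Proof.
move=> N_free; elim/ltn_ind => -[_|[_|n IHn]]; [exact: clique_lay0|exact: clique_lay1|].
move=> d d' dn d'n dd'; apply/negPn/negP=> ndd'.
have [w [w' [s [[wn w'n sn] [ws w's ww'] [wd w'd'] [wd' w'd sd sd']]]]] :=
  layer_gap (IHn _ (ltnSn _)) dn d'n dd' ndd'.
have [s' ss' far] := below sn.
apply: N_free; apply: (@N111_induced _ s w w' s' d d'); try solve_adj.
- by rewrite adj_sym; apply: (far n.+1).
- by rewrite adj_sym; apply: (far n.+1).
- by apply: (far n.+2).
- by apply: (far n.+2).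
Qed.

(** Here the triangle of [layer_gap] contains [u] itself, so the path of two vertices in [B12]
    cannot descend through layers and has to use [H] or [v]. *)
Lemma clique_lay2_B12 v : ~ induced_in B12 G -> att v -> v != u -> clique (L 2).
Proof.
move=> B_free vA vu w w' w2 w'2 ww'; apply/negPn/negP=> nww'.
have [t [t' [s [[t1 t'1 s0] [ts t's tt'] [tw t'w'] [tw' t'w _ _]]]]] :=
  layer_gap clique_lay1 w2 w'2 ww' nww'.
rewrite (lay0 s0) {s s0} in ts t's *.
have wY := layS_inner w2; have w'Y := layS_inner w'2.
have tY := layS_inner t1; have t'Y := layS_inner t'1.
have vt : ~~ adj v t by apply: inner_nbr_att => //; rewrite adj_sym.
have vt' : ~~ adj v t' by apply: inner_nbr_att => //; rewrite adj_sym.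
have u0 : u \in L 0 by rewrite lay_root.
have uw : ~~ adj u w := lay_far (ltnSn 1) u0 w2.
have uw' : ~~ adj u w' := lay_far (ltnSn 1) u0 w'2.
have not_both : adj v w -> adj v w' -> False.
  by move=> vw vw'; case/negP: nww'; apply: att_nbr_clique vw vw' ww'.
have [un _ _] := next_c_adj (att_c u_att); have [vn _ _] := next_c_adj (att_c vA).
have nuY := next_inner u_att; have nvY := next_inner vA.
have [uv|nuv] := boolP (adj u v).
  have [x xH ux] := att_adj u_att.
  have xv : adj x v.
    apply: (@claw u (next c u)) => //; last by rewrite adj_sym inner_nbr_att.
    - by rewrite eq_sym inner_neqH.
    - by rewrite eq_sym att_inner.
    - exact: att_neqH xH.
    - by rewrite inner_H.
  (* Otherwise the triangle [v], [u], [x] with the pendant vertex [t2] at [v] and the path [tz], [z]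
     at [u] is an induced [B12]. *)
  have full z tz t2 : z \in L 2 -> tz \in L 1 -> adj tz z -> ~~ adj v z ->
      t2 \in inner -> adj v t2 -> adj t2 z.
    move=> z2 tz1 tzz vz t2Y vt2; apply/negPn/negP=> nt2z.
    have uz : ~~ adj u z := lay_far (ltnSn 1) u0 z2.
    have := tz1; rewrite lay1P => /andP[tzY utz].
    have vtz : ~~ adj v tz by apply: inner_nbr_att.
    have ut2 : ~~ adj u t2 by apply: contraL vt2; apply: inner_nbr_att.
    have t2z : t2 != z by apply: contraNneq vz => <-.
    have t2tz : ~~ adj t2 tz.
      apply/negP=> t2tz; case/negP: nt2z; apply: (@claw tz u) => //; try solve_adj.
      - exact: att_inner.
      - by apply: att_inner => //; apply: layS_inner z2.
    apply: B_free; apply: (@B12_induced _ v u x t2 tz z); try solve_adj.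
    - by rewrite adj_sym inner_H.
    - by rewrite adj_sym inner_H.
    - by rewrite adj_sym inner_H // (layS_inner z2).
  have [vw|vw] := boolP (adj v w).
    have vw' : ~~ adj v w' by apply/negP; apply: not_both.
    by case/negP: nww'; apply: (full w' t').
  have [vw'|vw'] := boolP (adj v w').
    by case/negP: nww'; rewrite adj_sym; apply: (full w t).
  (* Now [v] misses both [w] and [w'], while its successor sees both by [full]. *)
  case/negP: nww'; apply: (@claw (next c v) v) => //.
  - by rewrite adj_sym.
  - by apply: (full w t).
  - by apply: (full w' t').
  - exact: att_inner.
  - exact: att_inner.
(* The path [x], [y] to be attached at [u]: if [u] and [v] share a neighbour in [H], it ends at [v];
   otherwise it is an edge where a path in [H] towards a neighbour of [v] leaves the neighbourhood
   of [u]. *)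
have [x [y [xH ux xy [uy ty t'y] wy]]] : exists x y, [/\ x \in H, adj u x,
    adj x y, [/\ ~~ adj u y, ~~ adj t y & ~~ adj t' y] & ~~ adj w y \/ ~~ adj w' y].
  have [x xH ux] := att_adj u_att; have [z zH vz] := att_adj vA.
  have [/existsP[y /and3P[yH uy vy]]|none] :=
      boolP [exists y, [&& y \in H, adj u y & adj v y]].
    exists y, v; split=> //; try by rewrite adj_sym.
      by split=> //; rewrite adj_sym.
    rewrite !(adj_sym _ v); apply/orP; rewrite -negb_and.
    by apply/negP=> /andP[vw vw']; apply: not_both.
  have nuz : ~~ adj u z.
    by apply: contra none => uz; apply/existsP; exists z; rewrite zH uz.
  have [p [xp pz _ pH]] := H_connected xH zH.
  rewrite -pz in nuz.
  have [a [b [ap bp ab ua ub]]] := path_crossing xp ux nuz.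
  exists a, b; split=> //; first exact: pH.
    by split=> //; apply: inner_H => //; apply: pH.
  by left; apply: inner_H => //; apply: pH.
rewrite adj_sym in ts; rewrite adj_sym in t's.
case: wy => [wy|w'y]; apply: B_free.
  by apply: (@B12_induced _ t u t' w x y); try solve_adj; apply: inner_H.
apply: (@B12_induced _ t' u t w' x y); try solve_adj; try exact: inner_H.
Qed.

(** From layer 3 on there is room to descend twice from [s]: the triangle [w], [s], [w'] with the
    pendant [d] at [w] and the path [s'], [s''] at [s] is a [B12]. *)
Lemma lay_clique_B12 v : ~ induced_in B12 G -> att v -> v != u ->
  forall n, clique (L n).
Proof.
move=> B_free vA vu; elim/ltn_ind => -[_|[_|[_|n IHn]]].
- exact: clique_lay0.
- exact: clique_lay1.
- exact: clique_lay2_B12 vA vu.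
move=> d d' dn d'n dd'; apply/negPn/negP=> ndd'.
have [w [w' [s [[wn w'n sn] [ws w's ww'] [wd w'd'] [wd' w'd sd sd']]]]] :=
  layer_gap (IHn _ (ltnSn _)) dn d'n dd' ndd'.
have [s' s'n s's] := lay_pred sn; have [s'' s's'' far] := below s'n.
apply: B_free; apply: (@B12_induced _ w s w' d s' s''); try solve_adj.
- by rewrite adj_sym; apply: lay_far s'n wn.
- by rewrite adj_sym; apply: (far n.+2) => //; apply: leqnSn.
- by rewrite adj_sym; apply: (far n.+1).
- by rewrite adj_sym; apply: lay_far s'n w'n.
- by rewrite adj_sym; apply: (far n.+2) => //; apply: leqnSn.
- by rewrite adj_sym; apply: lay_far s'n dn.
- by rewrite adj_sym; apply: (far n.+3) => //; apply: leqW.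
Qed.

Lemma no_clique_layers v : att v -> v != u -> ~ (forall n, clique (L n)).
Proof.
move=> vA vu cl; have [i [a [t [aA au ti]]]] := layers_reach_att vA vu.
by apply/negP; apply: (@no_att_near_clique_layers i.+1) ti => //; rewrite leqnn.
Qed.

End Root.

Notation L := (lay (@adj G) inner).

Section Z4.
Hypothesis Z4_free : ~ induced_in Z4 G.

(** * No induced [Z4]: an attached vertex with two neighbours in [H] *)

Section TwoNeighbours.
Variables u z y : G.
Hypothesis u_att : att u.
Hypothesis zH : z \in H.
Hypothesis yH : y \in H.
Hypothesis zy : z != y.
Hypothesis uz : adj u z.
Hypothesis uy : adj u y.

(** The vertices [u], [z], [y] form a triangle by [att_nbr_H_clique], and the path hangs off it at
    [u]. *)
Lemma no_induced_path4 p q r s : p \in inner -> q \in inner -> r \in inner ->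
  s \in inner -> adj u p -> adj p q -> adj q r -> adj r s ->
  ~~ adj u q -> ~~ adj u r -> ~~ adj u s -> ~~ adj p r -> ~~ adj p s ->
  ~~ adj q s -> False.
Proof.
move=> *; apply: Z4_free; apply: (@Z4_induced _ u z y p q r s) => //;
  try (by rewrite adj_sym inner_H).
exact: (@att_nbr_H_clique u).
Qed.

(** Such an edge would place [s], a neighbour of the attached [u], in layer 1 or 2 of [v], and it
    would also force layer 2 of [v] to be a clique. *)
Lemma no_edge_between_nbrs v s t : att v -> v != u -> s \in inner -> t \in inner ->
  adj u s -> adj v t -> ~~ adj s t.
Proof.
move=> vA vu sY tY us vt; apply/negP=> st0.
have nbr_u s' : s' \in inner -> adj u s' -> ~~ adj v s' by apply: inner_nbr_att.
have nbr_v t' : t' \in inner -> adj v t' -> ~~ adj u t'.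
  by move=> t'Y; apply: contraL; apply: nbr_u.
(* If [s'] missed [w], then [s'], [t'], [r], [w] would be an induced path hanging off [u]. *)
have exits s' t' r w : s' \in inner -> adj u s' -> t' \in inner -> adj v t' ->
    adj s' t' -> r \in inner -> adj v r -> w \in inner -> ~~ adj v w -> adj r w ->
    ~~ adj u w -> adj s' w.
  move=> s'Y us' t'Y vt' st rY vr wY vw rw uw; apply/negPn/negP=> nsw.
  have sw : s' != w by apply: contraNneq uw => <-.
  have vs := nbr_u _ s'Y us'.
  have rs : ~~ adj r s'.
    apply/negP=> rs; case/negP: nsw; apply: (@claw r v) => //; try exact: att_inner.
    by rewrite adj_sym.
  have tw : ~~ adj t' w.
    apply/negP=> tw; case/negP: nsw; apply: (@claw t' v) => //; try exact: att_inner.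
      by rewrite adj_sym.
    by rewrite adj_sym.
  have tr : adj t' r.
    by apply: att_nbr_clique vt' vr _ => //; apply: contraNneq rs => <-; rewrite adj_sym.
  by apply: (@no_induced_path4 s' t' r w) => //; rewrite ?nbr_v // adj_sym.
have far2 w : w \in L v 2 -> ~~ adj v w.
  exact: (lay_far (ltnSn 1) (lay_root _ _ v)).
have cl2 : clique (L v 2).
  have one w1 w2 : w1 \in L v 2 -> w2 \in L v 2 -> adj u w1 -> ~~ adj u w2 -> adj w1 w2.
    move=> w12 w22 uw1 uw2.
    have [r1 r11 r1w1] := lay_pred w12; have [r2 r21 r2w2] := lay_pred w22.
    move: r11 r21; rewrite !lay1P // => /andP[r1Y vr1] /andP[r2Y vr2].
    apply: (exits w1 r1 r2 w2) => //; rewrite ?far2 ?(layS_inner w12) ?(layS_inner w22) //.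
    by rewrite adj_sym.
  move=> w1 w2 w12 w22 neq; have w1Y := layS_inner w12; have w2Y := layS_inner w22.
  have [uw1|uw1] := boolP (adj u w1); have [uw2|uw2] := boolP (adj u w2).
  - exact: att_nbr_clique uw1 uw2 neq.
  - exact: one.
  - by rewrite adj_sym one.
  (* When [u] sees neither [w1] nor [w2], the vertex [s] sees both, and the claw at [s] with [u]
     joins them. *)
  have sw w : w \in L v 2 -> ~~ adj u w -> adj s w.
    move=> w2' uw; have [r r1 rw] := lay_pred w2'.
    move: r1; rewrite lay1P // => /andP[rY vr].
    by apply: (exits s t r w); rewrite ?far2 ?(layS_inner w2').
  apply: (@claw s u) => //; try exact: att_inner; try exact: sw.
  by rewrite adj_sym.
have t1 : t \in L v 1 by rewrite lay1P // tY.
have [[|j] lej sj] := lay_step t1 sY (etrans (adj_sym t s) st0).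
  by move: sY; rewrite (lay0 sj) (negPf (attNinner vA)).
have: ~~ adj u s; last by rewrite us.
apply: (@no_att_near_clique_layers v vA 2 _ j.+1) => //; last by rewrite eq_sym.
case=> [|[|[|]]] // _; [exact: clique_lay0|exact: clique_lay1].
Qed.

Variable v : G.
Hypothesis v_att : att v.
Hypothesis vu : v != u.

Lemma lay4_empty x : x \notin L u 4.
Proof.
apply/negP=> x4.
have [l3 l33 l3x] := lay_pred x4; have [l2 l22 l23] := lay_pred l33.
have [l1 l11 l12] := lay_pred l22.
have u0 : u \in L u 0 by rewrite lay_root.
have ul1 : adj u l1 by move: l11; rewrite lay1P // => /andP[].
apply: (@no_induced_path4 l1 l2 l3 x) => //; try (by apply: layS_inner; eauto).
- exact: (lay_far _ u0 l22).
- exact: (lay_far _ u0 l33).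
- exact: (lay_far _ u0 x4).
- exact: (lay_far _ l11 l33).
- exact: (lay_far _ l11 x4).
- exact: (lay_far _ l22 x4).
Qed.

(** The inner neighbours of [a] all lie in layer 3 of [u], the last one. From there, the layers of
    [a] up to the third turn out to be cliques, and they already contain a neighbour of [u]. *)
Lemma two_neighbours_false : False.
Proof.
have u0 : u \in L u 0 by rewrite lay_root.
have [i [a [t [aA au ti at_]]]] := layers_reach_att u_att v_att vu.
have notL1 x : x \in L u 1 -> ~~ adj a x.
  by rewrite lay1P // => /andP[xY ux]; apply: (@inner_nbr_att u).
have notL2 x : x \in L u 2 -> ~~ adj a x.
  move=> x2; have [s s1 sx] := lay_pred x2; move: s1; rewrite lay1P // => /andP[sY us].
  by apply: contraL sx => ax; apply: (@no_edge_between_nbrs a) => //; apply: layS_inner x2.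
have no_lay k x : x \notin L u (4 + k).
  elim: k x => [|k IHk] x; first exact: lay4_empty.
  by apply/negP=> xk; have [y' /negPn] := lay_pred xk; rewrite IHk.
have t3 : t \in L u 3.
  case: i ti => [|[|[|i]]] // ti; first by rewrite (negPf (notL1 _ ti)) in at_.
    by rewrite (negPf (notL2 _ ti)) in at_.
  by have := no_lay i t; rewrite ti.
have nbr3 w l : w \in inner -> l \in L u 3 -> adj l w -> w \in L u 2 \/ w \in L u 3.
  move=> wY l3 lw; have [[|[|[|[|[|j]]]]] // _ wj] := lay_step l3 wY lw.
  - by rewrite (lay0 wj) (negPf (attNinner u_att)) in wY.
  - by have := lay_far (ltnSn 2) wj l3; rewrite adj_sym lw.
  - by left.
  - by right.
  - by have := lay4_empty w; rewrite wj.
have nbr2 w l : w \in inner -> l \in L u 2 -> adj l w ->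
    [\/ w \in L u 1, w \in L u 2 | w \in L u 3].
  move=> wY l2 lw; have [[|[|[|[|j]]]] // _ wj] := lay_step l2 wY lw.
  - by rewrite (lay0 wj) (negPf (attNinner u_att)) in wY.
  - by constructor 1.
  - by constructor 2.
  - by constructor 3.
have nbr_a x : x \in inner -> adj a x -> x \in L u 3.
  move=> xY ax; have [->//|xt] := eqVneq x t.
  have tx : adj t x by apply: att_nbr_clique at_ ax _ => //; [apply: layS_inner t3|rewrite eq_sym].
  have [x2|//] := nbr3 _ _ xY t3 tx.
  by rewrite (negPf (notL2 _ x2)) in ax.
(* A vertex of layer 2 sees all or nothing of each component of layer 3. *)
have spread s l e : s \in L u 2 -> l \in L u 3 -> e \in L u 3 -> adj s l ->
    adj l e -> adj s e.
  move=> s2 l3 e3 sl le; apply/negPn/negP=> nse; have [s1 s11 s1s] := lay_pred s2.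
  have us1 : adj u s1 by move: s11; rewrite lay1P // => /andP[].
  apply: (@no_induced_path4 s1 s l e) => //; try (by apply: layS_inner; eauto).
  - exact: (lay_far _ u0 s2).
  - exact: (lay_far _ u0 l3).
  - exact: (lay_far _ u0 e3).
  - exact: (lay_far _ s11 l3).
  - exact: (lay_far _ s11 e3).
(* The claw at [s] with its predecessor in layer 1. *)
have merge s l e : s \in L u 2 -> l \in L u 3 -> e \in L u 3 -> adj s l ->
    adj s e -> l != e -> adj l e.
  move=> s2 l3 e3 sl se le; have [s1 s11 s1s] := lay_pred s2.
  apply: (@claw s s1) => //.
  - by rewrite adj_sym.
  - exact: lay_neq s11 l3.
  - exact: lay_neq s11 e3.
  - exact: (lay_far _ s11 l3).
  - exact: (lay_far _ s11 e3).
have t1 : t \in L a 1 by rewrite lay1P // (layS_inner t3).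
have in_a1 x : x \in L a 1 -> x \in L u 3.
  by rewrite lay1P // => /andP[xY ax]; apply: nbr_a.
have [s s2 st0] := lay_pred t3.
have cl1 := clique_lay1 aA.
have s_a1 x : x \in L a 1 -> adj s x.
  move=> x1; have [->//|xt] := eqVneq x t.
  by apply: (spread s t); rewrite ?in_a1 // cl1 // eq_sym.
have full w r : w \in L a 2 -> r \in L a 1 -> adj w r.
  move=> w2 r1; have [r0 r01 r0w] := lay_pred w2; have wY := layS_inner w2.
  have [->|r0r] := eqVneq r r0; first by rewrite adj_sym.
  have [wu2|wu3] := nbr3 _ _ wY (in_a1 _ r01) r0w.
    by apply: (spread w r0); rewrite ?in_a1 1?adj_sym // cl1 // eq_sym.
  apply: (merge s) => //; [exact: in_a1 | | exact: s_a1 | exact: lay_neq w2 r1].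
  by apply: (spread s r0) => //; [apply: in_a1 | apply: s_a1].
have a0 : a \in L a 0 by rewrite lay_root.
have far2 w : w \in L a 2 -> ~~ adj a w by apply: (lay_far _ a0).
have cl2 : clique (L a 2).
  move=> w w' w2 w'2 ww'; apply: (@claw t a) => //; rewrite ?far2 //.
  - by rewrite adj_sym.
  - by rewrite adj_sym full.
  - by rewrite adj_sym full.
  - exact: lay_neq a0 w2.
  - exact: lay_neq a0 w'2.
have cl3 : clique (L a 3).
  move=> d d' d3 d'3 dd'; apply/negPn/negP=> ndd'.
  have [w [w' [r [[w2 w'2 r1] [wr w'r ww'] [wd w'd'] [wd' w'd rd rd']]]]] :=
    layer_gap cl2 d3 d'3 dd' ndd'.
  (* In the other cases [spread] and [merge] would make [f] adjacent to [t], although they lie two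
     layers apart as seen from [a]. *)
  have cases x f : x \in L a 2 -> f \in L a 3 -> adj x f ->
      x \in L u 2 /\ (f \in L u 1 \/ f \in L u 2).
    move=> x2 f3 xf; have xY := layS_inner x2; have fY := layS_inner f3.
    have tf : ~~ adj t f := lay_far (ltnSn 2) t1 f3.
    have xt := full _ _ x2 t1.
    have tf_neq : t != f by apply: lay_neq t1 f3.
    have [xu2|xu3] := nbr3 _ _ xY t3 (etrans (adj_sym t x) xt).
      split=> //; have [|//|f3'] := nbr2 _ _ fY xu2 xf; [by left|by right|].
      by case/negP: tf; apply: (merge x).
    case/negP: tf; have [fu2|fu3] := nbr3 _ _ fY xu3 xf.
      by rewrite adj_sym; apply: (spread f x) => //; rewrite adj_sym.
    apply: (merge s) => //; apply: (spread s x) => //.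
    by apply: (spread s t) => //; rewrite adj_sym.
  (* With a predecessor [m] of [w1'] in layer 1 of [u], the path [m], [w1'], [w1], [d1] is induced
     and hangs off [u]. Hence [d] and [d'] can only lie in layer 1 of [u], a clique. *)
  have noL2 d1 w1 w1' : d1 \in L a 3 -> d1 \in L u 2 -> w1 \in L u 2 ->
      w1' \in L u 2 -> w1 \in L a 2 -> w1' \in L a 2 -> adj w1 d1 -> adj w1 w1' -> ~~ adj w1' d1 -> False.
    move=> {}d3 du2 wu2 w'u2 {}w2 {}w'2 {}wd {}ww' {}w'd.
    have [m m1 mw'] := lay_pred w'u2; have mY := layS_inner m1.
    have um : adj u m by move: m1; rewrite lay1P // => /andP[].
    have tm : ~~ adj t m by rewrite adj_sym; apply: lay_far m1 t3.
    have md : ~~ adj m d1.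
      apply: contra w'd => md; rewrite adj_sym; apply: (@claw m u) => //.
      - by rewrite adj_sym.
      - exact: lay_neq u0 du2.
      - exact: lay_neq u0 w'u2.
      - exact: lay_neq d3 w'2.
      - exact: (lay_far _ u0 du2).
      - exact: (lay_far _ u0 w'u2).
    have mw : ~~ adj m w1.
      apply: contra md => mw; apply: (@claw w1 t) => //.
      - by rewrite full.
      - by rewrite adj_sym.
      - by rewrite eq_sym; apply: lay_neq m1 t3.
      - exact: lay_neq t1 d3.
      - exact: lay_neq m1 du2.
      - exact: (lay_far _ t1 d3).
    apply: (@no_induced_path4 m w1' w1 d1) => //; try (by apply: layS_inner; eauto).
    - by rewrite adj_sym.
    - exact: (lay_far _ u0 w'u2).
    - exact: (lay_far _ u0 wu2).
    - exact: (lay_far _ u0 du2).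
  have [wu2 [d1|d2]] := cases _ _ w2 d3 wd; last first.
    have [w'u2 _] := cases _ _ w'2 d'3 w'd'.
    exact: (noL2 d w w').
  have [w'u2 [d'1|d'2]] := cases _ _ w'2 d'3 w'd'; last first.
    by apply: (noL2 d' w' w) => //; rewrite adj_sym.
  by case/negP: ndd'; apply: (clique_lay1 u_att).
(* The walk [a], [t], [s], [m] shows that [m], a neighbour of [u], is in one of the first three
   layers of [a]. *)
have [m m1 ms] := lay_pred s2; have mY := layS_inner m1; have sY := layS_inner s2.
have um : adj u m by move: m1; rewrite lay1P // => /andP[].
have [j lej sj] := lay_step t1 sY (etrans (adj_sym t s) st0).
have [[|k] lek mk] := lay_step sj mY (etrans (adj_sym s m) ms).
  by rewrite (lay0 mk) (negPf (attNinner aA)) in mY.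
have: ~~ adj u m; last by rewrite um.
apply: (@no_att_near_clique_layers a aA 3 _ k.+1) => //.
- by case=> [|[|[|[|]]]] // _; apply: clique_lay0.
- by rewrite (leq_trans lek).
- by rewrite eq_sym.
Qed.

End TwoNeighbours.

(** * No induced [Z4]: one neighbour in [H] per attached vertex *)

Section OneNeighbour.
Hypothesis one_nbr : forall w x y, att w -> x \in H -> y \in H ->
  adj w x -> adj w y -> x = y.

Section Pair.
Variables u v x x' : G.
Hypothesis u_att : att u.
Hypothesis v_att : att v.
Hypothesis xH : x \in H.
Hypothesis x'H : x' \in H.
Hypothesis ux : adj u x.
Hypothesis vx' : adj v x'.
Hypothesis neq_xx' : x != x'.

Lemma one_nbr_neq w y z : att w -> y \in H -> z \in H -> adj w y -> y != z -> ~~ adj w z.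
Proof. by move=> wA yH zH wy; apply: contraNN => /(one_nbr wA yH zH wy)->. Qed.

Lemma pair_neq : v != u.
Proof.
by apply: contraNneq neq_xx' => evu; rewrite (one_nbr u_att xH x'H ux) // -evu.
Qed.

(** Otherwise the claw at [u] with leaves [next c u], [x], [v] gives [v] the second neighbour [x] in
    [H]. *)
Lemma pair_nadj : ~~ adj u v.
Proof.
have [un _ _] := next_c_adj (att_c u_att); have nY := next_inner u_att.
have vx : ~~ adj v x by apply: one_nbr_neq vx' _; rewrite // eq_sym.
apply: contra vx => uv; rewrite adj_sym; apply: (@claw u (next c u)) => //.
- by rewrite eq_sym inner_neqH.
- by rewrite eq_sym att_inner.
- exact: att_neqH xH.
- exact: inner_H.
- by rewrite adj_sym; apply: (@inner_nbr_att u) => //; apply: pair_neq.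
Qed.

Lemma nbr_att_disjoint t : t \in inner -> adj u t -> ~~ adj v t.
Proof. by move=> tY ut; apply: (@inner_nbr_att u) => //; apply: pair_neq. Qed.

(** The triangle of [u] and its two neighbours on [c] continues into a shortest path of [H] from
    [x]. At distance 2 the path to [x'] is extended by [v]; at distance 3 or more it is long enough
    itself for a [Z4]. *)
Lemma pair_adj : adj x x'.
Proof.
have [un up np] := next_c_adj (att_c u_att).
have nY := next_inner u_att; have pY := prev_inner u_att.
have np' : adj (next c u) (prev c u) by apply: att_nbr_clique un up np.
have xy_nadj y : y \in H -> x != y -> ~~ adj u y.
  by move=> yH; apply: one_nbr_neq.
have no_path y1 y2 y3 : y1 \in H -> y2 \in H -> adj x y1 -> adj y1 y2 -> adj y2 y3 ->
    ~~ adj x y2 -> ~~ adj x y3 -> ~~ adj y1 y3 -> x != y2 ->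
    ~~ adj u y3 -> ~~ adj (next c u) y3 -> ~~ adj (prev c u) y3 -> False.
  move=> y1H y2H xy1 y12 y23 nxy2 nxy3 ny13 xy2 uy3 ny3 py3.
  have xy1n := adj_neq xy1.
  apply: Z4_free; apply: (@Z4_induced _ u (next c u) (prev c u) x y1 y2 y3) => //;
    first [exact: inner_H | exact: xy_nadj].
pose M := lay (@adj G) H x.
have M_H i y : y \in M i -> y \in H.
  by case: i => [|i] yi; [rewrite (lay0 yi) | apply: layS_sub yi].
have x0 : x \in M 0 by apply: lay_root.
have [n x'n] : exists n, x' \in M n.
  have [p [xp px' _ pH]] := H_connected xH x'H; rewrite -px'.
  have {pH}: {subset p <= H} by move=> y yp; apply: pH; rewrite inE yp orbT.
  elim: p x 0 x0 xp {px'} => [|y p IHp] z i zi /=; first by exists i.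
  case/andP=> zy yp pH; have [|j _ yj] := lay_step zi _ zy.
    by apply: pH; rewrite mem_head.
  by apply: (IHp y j yj yp) => w wp; apply: pH; rewrite inE wp orbT.
case: n x'n => [|[|[|n]]] x'n.
- by case/eqP: neq_xx'; rewrite (lay0 x'n).
- by have [z /lay0->] := lay_pred x'n.
- have [y1 y11 y1x'] := lay_pred x'n; have [z /lay0-> xy1] := lay_pred y11.
  have vx y : y \in H -> y != x' -> ~~ adj y v.
    by move=> yH yx'; rewrite adj_sym; apply: one_nbr_neq vx' _; rewrite // eq_sym.
  case: (@no_path y1 x' v) => //.
  + exact: M_H y11.
  + by rewrite adj_sym.
  + exact: lay_far x0 x'n.
  + exact: vx.
  + by apply: vx; [apply: M_H y11 | apply: adj_neq].
  + exact: pair_nadj.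
  + by rewrite adj_sym nbr_att_disjoint.
  + by rewrite adj_sym nbr_att_disjoint.
have [y3 y33] : exists y3, y3 \in M 3.
  elim: n {x'n} x' x'n => [|n IHn] y yn; first by exists y.
  by have [z /IHn] := lay_pred yn.
have [y2 y22 y23] := lay_pred y33; have [y1 y11 y12] := lay_pred y22.
have [z /lay0-> xy1] := lay_pred y11.
have y3H := M_H _ _ y33.
case: (@no_path y1 y2 y3) => //; rewrite ?(M_H _ _ y11) ?(M_H _ _ y22) //; try exact: inner_H.
- exact: lay_far x0 y22.
- exact: lay_far x0 y33.
- exact: lay_far y11 y33.
- exact: lay_neq x0 y22.
- by apply: xy_nadj => //; apply: lay_neq x0 y33.
Qed.

(** Otherwise the triangle [u], [t], [t'] and the path [x], [x'], [v], [s] form a [Z4]. *)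
Lemma nbr_of_two t t' s : t \in inner -> t' \in inner -> s \in inner ->
  adj u t -> adj u t' -> t != t' -> adj v s -> adj t s || adj t' s.
Proof.
move=> tY t'Y sY ut ut' tt' vs; apply/negPn; rewrite negb_or; apply/negP=> /andP[ts t's].
have x'x : x' != x by rewrite eq_sym.
apply: Z4_free; apply: (@Z4_induced _ u t t' x x' v s) => //; try exact: inner_H.
- exact: att_nbr_clique ut ut' tt'.
- exact: pair_adj.
- by rewrite adj_sym.
- exact: one_nbr_neq ux _.
- exact: pair_nadj.
- by apply: contraL vs; apply: nbr_att_disjoint.
- by rewrite adj_sym nbr_att_disjoint.
- by rewrite adj_sym nbr_att_disjoint.
- by rewrite adj_sym; apply: one_nbr_neq vx' _.
- by rewrite adj_sym inner_H.
- by rewrite adj_sym inner_H.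
Qed.

(** Otherwise the triangle [t], [w], [w'] and the path [u], [x], [x'], [v] form a [Z4]. *)
Lemma exit_unique t w w' : t \in inner -> adj u t -> w \in inner -> w' \in inner ->
  adj t w -> adj t w' -> ~~ adj u w -> ~~ adj u w' -> ~~ adj v w -> ~~ adj v w' ->
  w = w'.
Proof.
move=> tY ut wY w'Y tw tw' uw uw' vw vw'; apply/eqP/negPn/negP=> ww'.
have x'x : x' != x by rewrite eq_sym.
apply: Z4_free; apply: (@Z4_induced _ t w w' u x x' v) => //; try exact: inner_H;
  try (by rewrite adj_sym // inner_H).
- by apply: (@claw t u) => //; rewrite 1?adj_sym //; apply: att_inner.
- exact: pair_adj.
- by rewrite adj_sym nbr_att_disjoint.
- exact: one_nbr_neq ux _.
- exact: pair_nadj.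
- by rewrite adj_sym; apply: one_nbr_neq vx' _.
Qed.

End Pair.

(** * Neighbours along [c], regardless of orientation *)

Definition c_nbr (a b : G) := (next c a == b) || (prev c a == b).

Lemma uniq_c : uniq c.
Proof. by case: c_longest => -[_ /andP[]]. Qed.

Lemma c_nbr_sym a b : c_nbr a b -> c_nbr b a.
Proof.
case/orP=> /eqP<-; apply/orP; [right | left].
  by rewrite (prev_next uniq_c).
by rewrite (next_prev uniq_c).
Qed.

Lemma c_nbr_adj a b : a \in c -> c_nbr a b -> adj a b /\ b \in c.
Proof.
move=> ac; have [an ap _] := next_c_adj ac.
by case/orP=> /eqP<-; rewrite ?mem_next ?mem_prev.
Qed.

Lemma c_nbr_other a b : a \in c -> c_nbr a b ->
  exists d, [/\ c_nbr a d, d != b & forall z, c_nbr a z -> z = b \/ z = d].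
Proof.
move=> ac ab; have [_ _ np] := next_c_adj ac; case/orP: ab => /eqP<-.
  exists (prev c a); split; [by rewrite /c_nbr eqxx orbT | by rewrite eq_sym |].
  by move=> z /orP[] /eqP->; [left | right].
exists (next c a); split; [by rewrite /c_nbr eqxx | by [] |].
by move=> z /orP[] /eqP->; [right | left].
Qed.

Lemma c_nbr_closed (S : seq G) a : a \in S -> a \in c ->
  (forall y z, y \in S -> c_nbr y z -> z \in S) -> {subset c <= S}.
Proof.
move=> aS ac cl; have [q [_ _ _ pq [_ _ pathq]]] := open_cycle_at ac.
have {pathq} : path [rel x y | next c x == y] a q.
  by apply: pathq; have := cycle_next uniq_c; apply: sub_cycle => x y /=; rewrite eq_sym.
move=> aq x; rewrite -(perm_mem pq); move: x.
elim: q a aS aq {pq ac} => [|b q IHq] a aS /=; first by move=> _ x; rewrite inE => /eqP->.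
case/andP=> ab bq x; rewrite inE => /predU1P[->//|].
by apply: IHq bq x; apply: cl aS _; rewrite /c_nbr ab.
Qed.

(** * The short cycle forced by two distinct neighbours in [H] *)

Section PairCycle.
Variables u v x x' : G.
Hypothesis u_att : att u.
Hypothesis v_att : att v.
Hypothesis xH : x \in H.
Hypothesis x'H : x' \in H.
Hypothesis ux : adj u x.
Hypothesis vx' : adj v x'.
Hypothesis neq_xx' : x != x'.

Let x'x : x' != x. Proof. by rewrite eq_sym. Qed.
Let uNv t : t \in inner -> adj u t -> ~~ adj v t.
Proof. exact: (nbr_att_disjoint u_att v_att xH x'H ux vx' neq_xx'). Qed.
Let vNu t : t \in inner -> adj v t -> ~~ adj u t.
Proof. by move=> tY; apply: contraL; apply: uNv. Qed.
Let vu : v != u.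
Proof. exact: (pair_neq u_att xH x'H ux vx' neq_xx'). Qed.

(** Let [f] follow [p] on [c] away from [u], and let [e] precede [t] on the side away from [v].
    Unless [f = t], the claw at [t] makes [e] a neighbour of [p], and [exit_unique] yields [f = e].
    So [c] passes from [u] to [v] through [p], possibly [f], and [t]. *)
Lemma c_segment p p' t t' : [/\ p \in inner, adj u p & p != p'] ->
  [/\ t \in inner, adj v t & adj p t] -> ~~ adj p' t -> ~~ adj p t' ->
  (forall z, z \in inner -> adj u z -> z = p \/ z = p') ->
  (forall z, z \in inner -> adj v z -> z = t \/ z = t') ->
  (forall z, c_nbr u z -> z = p \/ z = p') -> c_nbr u p -> c_nbr u p' ->
  (forall z, c_nbr v z -> z = t \/ z = t') -> c_nbr v t -> c_nbr v t' ->
  exists f, (forall y z, y \in [:: p; f; t] -> c_nbr y z -> z \in [:: u; v; p; f; t]) /\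
    (f = t \/ [/\ adj p f, adj f t, f \in inner, ~~ adj u f & ~~ adj v f]).
Proof.
move=> [pY up pp'] [tY vt pt] p't pt' Tu Tv nbu nup nup' nbv nvt nvt'.
have pc := inner_c pY; have tc := inner_c tY.
have uc := att_c u_att; have vc := att_c v_att.
have [f [npf fu nbp]] := c_nbr_other pc (c_nbr_sym nup).
have [e [nte ev nbt]] := c_nbr_other tc (c_nbr_sym nvt).
have [pf fc] := c_nbr_adj pc npf; have [te ec] := c_nbr_adj tc nte.
have u_p t0 : t0 \in inner -> t0 != u by rewrite eq_sym; apply: att_inner.
(* Otherwise [c] would be the triangle [u], [p], [p'] and miss [v]. *)
have fNp' : f != p'.
  apply/eqP=> efp'; have p'u := c_nbr_sym nup'; have p'p : c_nbr p' p.
    by rewrite -efp'; apply: c_nbr_sym.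
  have p'c : p' \in c by rewrite -efp'.
  have [d [_ _ nbp']] := c_nbr_other p'c p'u.
  have edp : p = d by case: (nbp' _ p'p) => // epu; move: pY; rewrite epu (negPf (attNinner u_att)).
  have sub : {subset c <= [:: u; p; p']}.
    apply: (@c_nbr_closed _ u) => //; first by rewrite inE eqxx.
    move=> y z; rewrite !inE => /or3P[]/eqP->.
    - by case/nbu=> ->; rewrite eqxx ?orbT.
    - by case/nbp=> ->; rewrite ?efp' eqxx ?orbT.
    - by case/nbp'=> ->; rewrite -?edp eqxx ?orbT.
  have := sub v vc; rewrite !inE (negPf vu) /= => /orP[]/eqP evp.
    by move: pY; rewrite -evp (negPf (attNinner v_att)).
  have p'u' : adj u p' by case: (c_nbr_adj uc nup').
  by move: p'u'; rewrite -evp (negPf (pair_nadj u_att v_att xH x'H ux vx' neq_xx')).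
have eNt' : e != t'.
  apply/eqP=> eet'; have t'v := c_nbr_sym nvt'; have t't : c_nbr t' t.
    by rewrite -eet'; apply: c_nbr_sym.
  have t'c : t' \in c by rewrite -eet'.
  have [d [_ _ nbt']] := c_nbr_other t'c t'v.
  have edt : t = d by case: (nbt' _ t't) => // etv; move: tY; rewrite etv (negPf (attNinner v_att)).
  have sub : {subset c <= [:: v; t; t']}.
    apply: (@c_nbr_closed _ v) => //; first by rewrite inE eqxx.
    move=> y z; rewrite !inE => /or3P[]/eqP->.
    - by case/nbv=> ->; rewrite eqxx ?orbT.
    - by case/nbt=> ->; rewrite ?eet' eqxx ?orbT.
    - by case/nbt'=> ->; rewrite -?edt eqxx ?orbT.
  have := sub u uc; rewrite !inE eq_sym (negPf vu) /= => /orP[]/eqP eut.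
    by move: tY; rewrite -eut (negPf (attNinner u_att)).
  have t'v' : adj v t' by case: (c_nbr_adj vc nvt').
  by move: t'v'; rewrite -eut adj_sym (negPf (pair_nadj u_att v_att xH x'H ux vx' neq_xx')).
have fY : f \in inner.
  rewrite inE fc /=; apply/negP=> fA.
  by have := inner_nbr_att u_att fA fu pY up; rewrite adj_sym pf.
have eY : e \in inner.
  rewrite inE ec /=; apply/negP=> eA.
  by have := inner_nbr_att v_att eA ev tY vt; rewrite adj_sym te.
have fp : f != p by rewrite eq_sym adj_neq.
have et : e != t by rewrite eq_sym adj_neq.
have uf : ~~ adj u f.
  by apply/negP=> /(Tu _ fY)[]/eqP; [rewrite (negPf fp) | rewrite (negPf fNp')].
have ve : ~~ adj v e.
  by apply/negP=> /(Tv _ eY)[]/eqP; [rewrite (negPf et) | rewrite (negPf eNt')].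
exists f; have [eft|nft] := eqVneq f t.
  split; [|by left]; have tp : c_nbr t p by rewrite -eft; apply: c_nbr_sym.
  have epe : p = e.
    by case: (nbt _ tp) => // epv; move: pY; rewrite epv (negPf (attNinner v_att)).
  move=> y z; rewrite !inE eft orbb => /orP[]/eqP->.
    by case/nbp=> ->; rewrite ?eft eqxx ?orbT.
  by case/nbt=> ->; rewrite -?epe eqxx ?orbT.
have vf : ~~ adj v f.
  apply/negP=> /(Tv _ fY)[]/eqP; first by rewrite (negPf nft).
  by move/eqP=> eft'; move: pf; rewrite eft' (negPf pt').
have ue : ~~ adj u e.
  apply/negP=> /(Tu _ eY)[ee|ee].
    have /nbp[] : c_nbr p t by rewrite -ee; apply: c_nbr_sym.
      by move=> etu; move: tY; rewrite etu (negPf (attNinner u_att)).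
    by move=> etf; rewrite etf eqxx in nft.
  by move: te; rewrite ee adj_sym (negPf p't).
have ep : adj e p.
  have ep : e != p by apply: contraNneq ue => ->.
  apply: (@claw t v) => //; try exact: att_inner; try (by rewrite adj_sym).
  exact: uNv.
have efe : f = e.
  apply: (exit_unique u_att v_att xH x'H ux vx' neq_xx' pY up) => //.
  by rewrite adj_sym.
have ft : adj f t by rewrite efe adj_sym.
split; last by right.
have [d [_ _ nbf]] := c_nbr_other fc (c_nbr_sym npf).
have etd : t = d.
  have /nbf[etp|//] : c_nbr f t by rewrite efe; apply: c_nbr_sym.
  by have := vNu tY vt; rewrite etp up.
move=> y z; rewrite !inE => /or3P[]/eqP->.
- by case/nbp=> ->; rewrite eqxx ?orbT.
- by case/nbf=> ->; rewrite -?etd eqxx ?orbT.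
- by case/nbt=> ->; rewrite -?efe eqxx ?orbT.
Qed.

Lemma pair_false : False.
Proof.
have uc := att_c u_att; have vc := att_c v_att.
have [un up unp] := next_c_adj uc; have [vn vp vnp] := next_c_adj vc.
have unY := next_inner u_att; have upY := prev_inner u_att.
have vnY := next_inner v_att; have vpY := prev_inner v_att.
have F1 := nbr_of_two u_att v_att xH x'H ux vx' neq_xx'.
have F1' := nbr_of_two v_att u_att x'H xH vx' ux x'x.
(* By [F1] some neighbour of [u] sees [next c v], which is then in layer 1 or 2 of [u], too close
   for a neighbour of [v]. *)
suff cl2 : clique (L u 2).
  have [p [p1 pa]] : exists p, p \in L u 1 /\ adj p (next c v).
    by case/orP: (F1 _ _ _ unY upY vnY un up unp vn) => ?;
      [exists (next c u) | exists (prev c u)]; rewrite lay1P // ?unY ?upY.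
  have [[|j] lej aj] := lay_step p1 vnY pa.
    by have := vnY; rewrite (lay0 aj) (negPf (attNinner u_att)).
  have: ~~ adj v (next c v); last by rewrite vn.
  apply: (@no_att_near_clique_layers u u_att 2 _ j.+1) => //.
  by case=> [|[|[|]]] // _; [apply: clique_lay0 | apply: clique_lay1].
move=> w1 w2 w12 w22 neq_w; apply/negPn/negP=> nw12.
have [p1 [p2 [s [[p11 p21 s0] [_ _ p12] [p1w1 p2w2] [p1w2 p2w1 uw1 uw2]]]]] :=
  layer_gap (clique_lay1 u_att) w12 w22 neq_w nw12.
rewrite (lay0 s0) {s s0} in uw1 uw2.
move: p11 p21; rewrite !lay1P // => /andP[p1Y up1] /andP[p2Y up2].
have w1Y := layS_inner w12; have w2Y := layS_inner w22.
have neq_p := adj_neq p12.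
have u_clique p w t : adj u p -> adj p w -> adj p t -> w \in inner -> t \in inner ->
    ~~ adj u w -> ~~ adj u t -> w != t -> adj w t.
  move=> up' pw pt wY tY uw ut wt.
  by apply: (@claw p u) => //; try exact: att_inner; rewrite adj_sym.
have v_clique t w p : adj v t -> adj t w -> adj t p -> w \in inner -> p \in inner ->
    ~~ adj v w -> ~~ adj v p -> w != p -> adj w p.
  move=> vt tw tp wY pY vw vp' wp.
  by apply: (@claw t v) => //; try exact: att_inner; rewrite adj_sym.
(* A common neighbour [t] would see [w1] and [w2] by claws at [p1] and [p2]. As [v] misses one of
   them, the claw at [t] with [v] would join it to the wrong one of [p1] and [p2]. *)
have excl t : t \in inner -> adj v t -> adj p1 t -> ~~ adj p2 t.
  move=> tY vt p1t; apply/negP=> p2t; have ut := vNu tY vt.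
  have w1t : w1 != t by apply: contraNneq p2w1 => ->.
  have w2t : w2 != t by apply: contraNneq p1w2 => ->.
  have tw1 : adj t w1 by rewrite adj_sym; apply: (u_clique p1).
  have tw2 : adj t w2 by rewrite adj_sym; apply: (u_clique p2).
  have [vw1|vw1] := boolP (adj v w1).
    have vw2 : ~~ adj v w2.
      by apply: contra nw12 => vw2; apply: att_nbr_clique vw1 vw2 neq_w.
    case/negP: p1w2; rewrite adj_sym; apply: (v_clique t) => //;
      [by rewrite adj_sym | exact: uNv | by apply: contraNneq uw2 => ->].
  case/negP: p2w1; rewrite adj_sym; apply: (v_clique t) => //;
    [by rewrite adj_sym | exact: uNv | by apply: contraNneq uw1 => ->].
have either t : t \in inner -> adj v t -> adj p1 t \/ adj p2 t.
  by move=> tY vt; apply/orP; apply: F1.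
have uniq1 t t' : t \in inner -> t' \in inner -> adj v t -> adj v t' ->
    adj p1 t -> adj p1 t' -> t = t'.
  move=> tY t'Y vt vt' p1t p1t'; apply/eqP/negPn/negP=> tt'.
  by case/orP: (F1' _ _ _ tY t'Y p2Y vt vt' tt' up2); rewrite adj_sym; apply/negP/excl.
have uniq2 t t' : t \in inner -> t' \in inner -> adj v t -> adj v t' ->
    adj p2 t -> adj p2 t' -> t = t'.
  move=> tY t'Y vt vt' p2t p2t'; apply/eqP/negPn/negP=> tt'.
  case/orP: (F1' _ _ _ tY t'Y p1Y vt vt' tt' up1) => tp.
    by case/negP: (excl _ tY vt (etrans (adj_sym p1 t) tp)).
  by case/negP: (excl _ t'Y vt' (etrans (adj_sym p1 t') tp)).
have [t [t' [[tY vt p1t] [t'Y vt' p2t'] tt' nbv]]] : exists t t',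
    [/\ [/\ t \in inner, adj v t & adj p1 t], [/\ t' \in inner, adj v t' & adj p2 t'],
        t != t' & (next c v = t /\ prev c v = t') \/ (next c v = t' /\ prev c v = t)].
  case: (either _ vnY vn) => [p1n|p2n]; case: (either _ vpY vp) => [p1p|p2p].
  - by case/eqP: vnp; apply: uniq1.
  - by exists (next c v), (prev c v); split=> //; left.
  - by exists (prev c v), (next c v); split=> //; [rewrite eq_sym | right].
  - by case/eqP: vnp; apply: uniq2.
have p2t : ~~ adj p2 t by apply: excl.
have p1t' : ~~ adj p1 t' by apply: contraL p2t'; apply: excl.
have Tv z : z \in inner -> adj v z -> z = t \/ z = t'.
  by move=> zY vz; case: (either z zY vz); [left; apply: uniq1 | right; apply: uniq2].
have Tu z : z \in inner -> adj u z -> z = p1 \/ z = p2.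
  (* A third neighbour [z] of [u] would see [t] and [t'] by [F1], then [w1] and [w2], and the claw
     at [z] with [u] would join [w1] to [w2]. *)
  move=> zY uz; have [->|zp1] := eqVneq z p1; first by left.
  have [->|zp2] := eqVneq z p2; first by right.
  have zt : adj z t by case/orP: (F1 _ _ _ zY p2Y tY uz up2 zp2 vt); rewrite ?(negPf p2t).
  have zt' : adj z t' by case/orP: (F1 _ _ _ zY p1Y t'Y uz up1 zp1 vt'); rewrite ?(negPf p1t').
  have far p s w : adj u p -> s \in inner -> adj v s -> adj p s -> w \in inner ->
      ~~ adj u w -> adj p w -> adj z s -> (forall s', s' \in inner -> adj v s' ->
      adj p s' -> s' = s) -> adj z w.
    move=> up' sY vs ps wY uw pw zs only; have [->//|ws] := eqVneq w s.
    have vw : ~~ adj v w by apply: contra ws => vw; rewrite (only w).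
    have sw : adj s w by rewrite adj_sym; apply: (u_clique p) => //; apply: vNu.
    rewrite adj_sym; apply: (v_clique s) => //;
      [by rewrite adj_sym | exact: uNv | by apply: contraNneq uw => ->].
  have zw1 : adj z w1 by apply: (far p1 t) => // s' s'Y vs' ps'; apply: uniq1.
  have zw2 : adj z w2 by apply: (far p2 t') => // s' s'Y vs' ps'; apply: uniq2.
  by case/negP: nw12; apply: (u_clique z).
have nbu : (next c u = p1 /\ prev c u = p2) \/ (next c u = p2 /\ prev c u = p1).
  case: (Tu _ unY un) (Tu _ upY up) => [n1|n2] [pr1|pr2]; [|by left|by right|];
    by rewrite ?n1 ?n2 ?pr1 ?pr2 eqxx in unp.
have nb_u z : c_nbr u z -> z = p1 \/ z = p2.
  by case/orP=> /eqP<-; apply: Tu.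
have nb_v z : c_nbr v z -> z = t \/ z = t'.
  by case/orP=> /eqP<-; apply: Tv.
have [nup1 nup2] : c_nbr u p1 /\ c_nbr u p2.
  by rewrite /c_nbr; case: nbu => -[-> ->]; rewrite !eqxx !orbT.
have [nvt nvt'] : c_nbr v t /\ c_nbr v t'.
  by rewrite /c_nbr; case: nbv => -[-> ->]; rewrite !eqxx !orbT.
have [f [clf _]] : exists f, (forall y z, y \in [:: p1; f; t] -> c_nbr y z ->
    z \in [:: u; v; p1; f; t]) /\
    (f = t \/ [/\ adj p1 f, adj f t, f \in inner, ~~ adj u f & ~~ adj v f]).
  exact: (@c_segment p1 p2 t t').
have [f' [clf' f'P]] : exists f, (forall y z, y \in [:: p2; f; t'] -> c_nbr y z ->
    z \in [:: u; v; p2; f; t']) /\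
    (f = t' \/ [/\ adj p2 f, adj f t', f \in inner, ~~ adj u f & ~~ adj v f]).
  apply: (@c_segment p2 p1 t' t) => //; first by rewrite eq_sym.
  - by move=> z zY uz; case: (Tu z zY uz); [right | left].
  - by move=> z zY vz; case: (Tv z zY vz); [right | left].
  - by move=> z /nb_u[]; [right | left].
  - by move=> z /nb_v[]; [right | left].
(* The two segments between [u] and [v] make up all of [c]. *)
have sub : {subset c <= [:: u; p1; f; t; v; t'; p2; f']}.
  apply: (@c_nbr_closed _ u) => //; first by rewrite inE eqxx.
  have ext1 z : z \in [:: u; v; p1; f; t] -> z \in [:: u; p1; f; t; v; t'; p2; f'].
    by rewrite !inE => /or4P[|||/orP[]] /eqP->; rewrite eqxx ?orbT.
  have ext2 z : z \in [:: u; v; p2; f'; t'] -> z \in [:: u; p1; f; t; v; t'; p2; f'].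
    by rewrite !inE => /or4P[|||/orP[]] /eqP->; rewrite eqxx ?orbT.
  move=> y z yS yz; have [/clf/(_ yz)/ext1//|y1] := boolP (y \in [:: p1; f; t]).
  have [/clf'/(_ yz)/ext2//|y2] := boolP (y \in [:: p2; f'; t']).
  move: yS y1 y2; rewrite !inE !negb_or => yS /and3P[/negPf y1 /negPf y2 /negPf y3].
  case/and3P=> /negPf y4 /negPf y5 /negPf y6.
  move: yS; rewrite y1 y2 y3 y4 y5 y6 !orbF /= => /orP[]/eqP ey; rewrite ey in yz.
    by case: (nb_u _ yz) => ->; rewrite eqxx ?orbT.
  by case: (nb_v _ yz) => ->; rewrite eqxx ?orbT.
have le8 := uniq_leq_size uniq_c sub.
have tt'a : adj t t' by apply: att_nbr_clique vt vt' tt'.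
have neq_inner a b : att a -> b \in inner -> (a == b = false) * (b == a = false).
  by move=> aA bY; rewrite [b == a]eq_sym; have /negPf-> := att_inner aA bY.
have neq_nbr p s : p \in inner -> adj u p -> adj v s -> (s == p) = false.
  by move=> pY up' vs; apply/negbTE; apply: contraTneq vs => ->; apply: uNv.
have xx'_path : path (@adj G) x [:: x'].
  by rewrite /= (pair_adj u_att v_att xH x'H ux vx' neq_xx').
have xx'_uniq : uniq [:: x; x'] by rewrite /= inE neq_xx'.
have xx'_H : {subset [:: x; x'] <= H} by move=> z; rewrite !inE => /orP[]/eqP->.
have uv : u != v by rewrite eq_sym.
have off_H l : all (mem c) l -> {subset l <= [predC H]}.
  by move=> /allP lc z /lc; apply: c_notin_H.
have tc := inner_c tY; have t'c := inner_c t'Y.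
have p1c := inner_c p1Y; have p2c := inner_c p2Y.
have p2u : adj p2 u by rewrite adj_sym.
have p1u : adj p1 u by rewrite adj_sym.
have p21 : adj p2 p1 by rewrite adj_sym.
have t'p2 : adj t' p2 by rewrite adj_sym.
(* The longer cycle goes from [v] to [t], over to [t'], along the second segment to [p2], over to
   [p1], and back from [u] through [x] and [x']; of [c] it omits at most [f]. For [f' = t'] it has 8
   vertices against at most 7, otherwise 9 against at most 8. *)
case: f'P => [ef'|[p2f' f't' f'Y uf' vf']].
  have sub7 : {subset c <= [:: u; p1; f; t; v; t'; p2]}.
    by move=> z /sub; rewrite ef' !inE; do ?[case: eqP => //=].
  have le7 := uniq_leq_size uniq_c sub7.
  have: 6 + 2 <= size c; last by move=> /leq_trans/(_ le7).
  apply: (@path_through_H u v x x' [:: t; t'; p2; p1; u] [:: x']) => //.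
  - by rewrite /= vt tt'a t'p2 p21 p1u.
  - rewrite /= !inE (negPf vu) (negPf tt') [p2 == p1]eq_sym (negPf neq_p).
    by rewrite !(neq_inner v) // !(neq_inner u) // !neq_nbr.
  - by apply: off_H; rewrite /= vc tc t'c p2c p1c uc.
have: 7 + 2 <= size c; last by move=> /leq_trans/(_ le8).
apply: (@path_through_H u v x x' [:: t; t'; f'; p2; p1; u] [:: x']) => //.
- by rewrite /= vt tt'a [adj t' f']adj_sym f't' [adj f' p2]adj_sym p2f' p21 p1u.
- have ne (w z : G) : ~~ adj z w -> forall s, adj z s -> (s == w = false) * (w == s = false).
    by move=> zw s zs; rewrite [w == s]eq_sym; case: eqP zw => // <-; rewrite zs.
  rewrite /= !inE (negPf vu) (negPf tt') [p2 == p1]eq_sym (negPf neq_p).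
  rewrite !(neq_inner v) // !(neq_inner u) // (neq_nbr _ _ p1Y up1 vt).
  rewrite (neq_nbr _ _ p1Y up1 vt') (neq_nbr _ _ p2Y up2 vt) (neq_nbr _ _ p2Y up2 vt').
  by rewrite !(ne _ _ vf' _ vt) !(ne _ _ vf' _ vt') !(ne _ _ uf' _ up1) !(ne _ _ uf' _ up2).
- by apply: off_H; rewrite /= vc tc t'c (inner_c f'Y) p2c p1c uc.
Qed.
End PairCycle.

End OneNeighbour.

End Z4.

(** * Attached vertices supplied by 2-connectedness *)

Section TwoConnected.
Hypothesis G_2connected : k_connected 2 G.
Variable x0 : G.
Hypothesis x0H : x0 \in H.

Lemma cut_edge (X S : {set G}) a b : connected_minus X -> a \in S -> a \notin X ->
  b \notin S -> b \notin X -> exists y z, [/\ y \in S, y \notin X, z \notin S, z \notin X & adj y z].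
Proof.
move=> connX aS aX bS bX; have /connectP[p ap eb] := connX a b aX bX.
rewrite eb in bS; have [y [z [_ _ yz yS zS]]] := path_crossing ap aS bS.
by case/and3P: yz => yz yX zX; exists y, z.
Qed.

(** As [u] is no cut vertex, some edge avoiding [u] leaves [H], and it can only end on [c]. *)
Lemma second_att u : att u -> exists2 v, att v & v != u.
Proof.
move=> uA; have [_ conn] := G_2connected.
have uc := att_c uA; have [un _ _] := next_c_adj uc.
have [|||||y [z [yH _ zH zu yz]]] := @cut_edge [set u] H x0 (next c u).
- by apply: conn; rewrite cards1.
- exact: x0H.
- by rewrite inE (att_neqH uA x0H).
- by rewrite c_notin_H // mem_next.
- by rewrite inE eq_sym adj_neq.
by exists z; [apply: H_att yz zH | rewrite inE in zu].
Qed.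

Lemma two_att : exists u v, [/\ att u, att v & v != u].
Proof.
have [_ conn] := G_2connected.
have [d dc] : exists d, d \in c.
  by case: c_longest => -[]; case: (c) => [|d q] // _ _; exists d; rewrite mem_head.
have [|||||y [u [yH _ uH _ yu]]] := @cut_edge set0 H x0 d; rewrite ?inE //.
- by apply: conn; rewrite cards0.
- exact: c_notin_H.
have uA := H_att yH yu uH; have [v vA vu] := second_att uA.
by exists u, v.
Qed.

Lemma N111_not_free : ~ ~ induced_in N111 G.
Proof.
move=> N_free; have [u [v [uA vA vu]]] := two_att.
exact: (no_clique_layers uA vA vu (lay_clique_N111 uA N_free)).
Qed.

Lemma B12_not_free : ~ ~ induced_in B12 G.
Proof.
move=> B_free; have [u [v [uA vA vu]]] := two_att.
exact: (no_clique_layers uA vA vu (lay_clique_B12 uA B_free vA vu)).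
Qed.

(** Two vertices in [H] are what makes [pair_false] applicable: as [x] is no cut vertex, an edge
    leaves [H] from a vertex other than [x], so some attached vertex has a neighbour different from
    [x]. *)
Lemma Z4_not_free y0 : y0 \in H -> y0 != x0 -> ~ ~ induced_in Z4 G.
Proof.
move=> y0H y0x0 Z_free; have [_ conn] := G_2connected.
have one_nbr w x y : att w -> x \in H -> y \in H -> adj w x -> adj w y -> x = y.
  move=> wA xH yH wx wy; apply/eqP/negPn/negP=> xy.
  have [v vA vw] := second_att wA.
  exact: (two_neighbours_false Z_free wA xH yH xy wx wy vA vw).
have [u [_ [uA _ _]]] := two_att; have [x xH ux] := att_adj uA.
have [a [aH ax]] : exists a, a \in H /\ a != x.
  by have [<-|] := eqVneq x0 x; [exists y0 | exists x0].
have [|||||y [v [yH yx vH vx yv]]] := @cut_edge [set x] H a u; rewrite ?inE //.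
- by apply: conn; rewrite cards1.
- exact/c_notin_H/att_c.
- by rewrite eq_sym att_neqH.
rewrite inE eq_sym in yx; have vA := H_att yH yv vH; rewrite adj_sym in yv.
exact: (pair_false Z_free one_nbr uA vA xH yH ux yv yx).
Qed.

End TwoConnected.
End LongestCycle.

Theorem theorem3 (Hs : seq sgraph)
  (hHs : List.In Hs [:: [:: K13; Z4]; [:: K13; B12]; [:: K13; N111]])
  (G : sgraph) (h2 : k_connected 2 G) (hfree : free Hs G)
  (c : seq G) (hc : longest_cycle c) :
  dominating_cycle c.
Proof.
have claw_free : ~ induced_in K13 G.
  by apply: hfree; case: hHs => [<-|[<-|[<-|[]]]]; left.
split=> [|x y xy]; first by case: hc.
apply/orP/negPn; rewrite negb_or; apply/negP=> /andP[xc yc].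
(* Adjacency in [G - c], so that [H] is the component containing the uncovered edge. *)
pose e := [rel a b : G | [&& adj a b, a \notin c & b \notin c]].
have e_sym : symmetric e by move=> a b; rewrite /= adj_sym [(b \notin c) && _]andbC.
have e_adj : subrel e (@adj G) by move=> a b /andP[].
pose H := [set z | connect e x z].
have xH : x \in H by rewrite inE connect0.
have yH : y \in H by rewrite inE connect1 //= xy xc.
have H_off z : z \in H -> z \notin c.
  rewrite inE => /connectP[p xp ->]; move: (x) xc xp.
  by elim: p => //= w p IHp a _ /andP[/and3P[_ _ wc]]; apply: IHp.
have H_closed a b : a \in H -> adj a b -> b \notin c -> b \in H.
  move=> aH ab bc; have := H_off _ aH; move: aH; rewrite !inE => xa ac.
  by apply: connect_trans xa (connect1 _); rewrite /= ab ac.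
have H_conn a b : a \in H -> b \in H ->
    exists p, [/\ path (@adj G) a p, last a p = b, uniq (a :: p) & {subset a :: p <= H}].
  rewrite !inE => xa xb; have: connect e a b.
    by apply: connect_trans xb; rewrite (sym_connect_sym e_sym).
  case/connectP=> p /shortenP[p' ap' up' _] ->; exists p'; split=> //.
    exact: sub_path ap'.
  move=> z /(path_connect ap') az; rewrite inE; apply: connect_trans xa az.
have neq_yx : y != x by apply: contraTneq xy => ->; rewrite adj_irrefl.
case: hHs => [eHs|[eHs|[eHs|[]]]]; rewrite -{}eHs in hfree.
- apply: (Z4_not_free claw_free hc H_off H_closed H_conn h2 xH yH neq_yx).
  by apply: hfree; right; left.
- apply: (B12_not_free claw_free hc H_off H_closed H_conn h2 xH).
  by apply: hfree; right; left.
- apply: (N111_not_free claw_free hc H_off H_closed H_conn h2 xH).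
  by apply: hfree; right; left.
Qed.
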